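(* Let $\mathcal{C}$ be a symmetric tensor category over a field of characteristic zero, let $V\in\mathcal{C}$, and let $A=T(V)$. Then for all $k\ge 2$, $$B_k= [A_{\leq 2},B_{k-1}].$$
   Context: A symmetric tensor category is a $k$-linear abelian symmetric monoidal category with exact bilinear tensor product, over a field of characteristic zero (e.g. vector spaces, where $T(\mathbb{C}^n)=A_n$ is the free associative algebra on $n$ generators). $T(V)=\bigoplus_i V^{\otimes i}$ is the tensor algebra (infinite sums taken in $\mathcal{C}$ or its ind-completion), and $A_{\le 2}=\mathbf{1}\oplus V\oplus V^{\otimes 2}$ is the part of degree at most 2. With symmetry $\sigma$ and multiplication $m$, the commutator on $A$ is $[\cdot,\cdot]=m\circ(\mathrm{id}-\sigma_{A,A})$. The lower central series is $L_1=A$, $L_{i+1}=[A,L_i]$ for $i\ge 1$, where $[X,Y]$ denotes the image of $X\otimes Y$ under the commutator, and $B_i:=L_i/L_{i+1}$. The commutator induces a morphism $A\otimes B_{k-1}\to B_k$, and $[A_{\le2},B_{k-1}]$ denotes the image of $A_{\le 2}\otimes B_{k-1}$ in $B_k$. *)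

(* Defs.v *)
From HB Require Import structures.
From mathcomp Require Import all_boot all_order all_algebra boolp.
Set Implicit Arguments.
Unset Strict Implicit.
Unset Printing Implicit Defensive.
Import GRing.Theory.
Local Open Scope ring_scope.

Declare Scope cat_scope.
Delimit Scope cat_scope with cat.
Reserved Notation "X ~> Y" (at level 90, no associativity).
Reserved Notation "X \ox Y" (at level 40, left associativity).
Reserved Notation "f \oxm g" (at level 40, left associativity).
Reserved Notation "X \bip Y" (at level 48, left associativity).

Record linCat (K : fieldType) := LinCat {
  ob :> Type;
  hom : ob -> ob -> lmodType K;
  idm : forall X, hom X X;
  cmp : forall X Y Z, hom Y Z -> hom X Y -> hom X Z;
  cmpA : forall W X Y Z (h : hom Y Z) (g : hom X Y) (f : hom W X),
    cmp h (cmp g f) = cmp (cmp h g) f;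
  cmp1m : forall X Y (f : hom X Y), cmp (idm Y) f = f;
  cmpm1 : forall X Y (f : hom X Y), cmp f (idm X) = f;
  cmpDr : forall X Y Z (a : K) (g : hom Y Z) (f1 f2 : hom X Y),
    cmp g (a *: f1 + f2) = a *: cmp g f1 + cmp g f2;
  cmpDl : forall X Y Z (a : K) (g1 g2 : hom Y Z) (f : hom X Y),
    cmp (a *: g1 + g2) f = a *: cmp g1 f + cmp g2 f
}.
Arguments hom {K l}.
Arguments idm {K l}.
Arguments cmp {K l X Y Z}.

Notation "X ~> Y" := (hom X Y) : cat_scope.
Notation "g \o f" := (cmp g f) : cat_scope.
Local Open Scope cat_scope.

Section LinCat.
Variables (K : fieldType) (C : linCat K).
Implicit Types X Y Z : C.

Definition is_iso X Y (f : X ~> Y) : Prop :=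
  exists g : Y ~> X, g \o f = idm X /\ f \o g = idm Y.

Definition is_mono X Y (f : X ~> Y) : Prop :=
  forall Z (g h : Z ~> X), f \o g = f \o h -> g = h.

Definition is_epi X Y (f : X ~> Y) : Prop :=
  forall Z (g h : Y ~> Z), g \o f = h \o f -> g = h.

Definition is_kernel Z X Y (f : X ~> Y) (i : Z ~> X) : Prop :=
  f \o i = 0 /\
  forall W (g : W ~> X), f \o g = 0 -> exists! h : W ~> Z, i \o h = g.

Definition is_cokernel X Y Z (f : X ~> Y) (p : Y ~> Z) : Prop :=
  p \o f = 0 /\
  forall W (g : Y ~> W), g \o f = 0 -> exists! h : Z ~> W, h \o p = g.

Definition is_coproduct (F : nat -> C) S (inj : forall n, F n ~> S) : Prop :=
  forall Y (f : forall n, F n ~> Y),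
    exists! h : S ~> Y, forall n, h \o inj n = f n.

End LinCat.

Record abCat (K : fieldType) := AbCat {
  ab_lin :> linCat K;
  zob : ab_lin;
  zobP : idm zob = 0;
  bip : ab_lin -> ab_lin -> ab_lin;
  bin1 : forall X Y, X ~> bip X Y;
  bin2 : forall X Y, Y ~> bip X Y;
  bpr1 : forall X Y, bip X Y ~> X;
  bpr2 : forall X Y, bip X Y ~> Y;
  bpr1_in1 : forall X Y, bpr1 X Y \o bin1 X Y = idm X;
  bpr2_in2 : forall X Y, bpr2 X Y \o bin2 X Y = idm Y;
  bpr1_in2 : forall X Y, bpr1 X Y \o bin2 X Y = 0;
  bpr2_in1 : forall X Y, bpr2 X Y \o bin1 X Y = 0;
  bip_id : forall X Y,
    (bin1 X Y \o bpr1 X Y) + (bin2 X Y \o bpr2 X Y) = idm (bip X Y);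
  ker : forall (X Y : ab_lin) (f : X ~> Y), ab_lin;
  kerm : forall (X Y : ab_lin) (f : X ~> Y), ker f ~> X;
  kerP : forall (X Y : ab_lin) (f : X ~> Y), is_kernel f (kerm f);
  cok : forall (X Y : ab_lin) (f : X ~> Y), ab_lin;
  cokm : forall (X Y : ab_lin) (f : X ~> Y), Y ~> cok f;
  cokP : forall (X Y : ab_lin) (f : X ~> Y), is_cokernel f (cokm f);
  mono_normal : forall (X Y : ab_lin) (f : X ~> Y),
    is_mono f -> is_kernel (cokm f) f;
  epi_conormal : forall (X Y : ab_lin) (f : X ~> Y),
    is_epi f -> is_cokernel (kerm f) f
}.
Arguments bin1 {K a X Y}.
Arguments bin2 {K a X Y}.
Arguments bpr1 {K a X Y}.
Arguments bpr2 {K a X Y}.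
Arguments kerm {K a X Y}.
Arguments cokm {K a X Y}.
Notation "X \bip Y" := (bip X Y) : cat_scope.

(* The monoidal structure is not assumed strict.  Exactness of the additive
   functors [X \ox -] and [- \ox X] is preservation of kernels and cokernels. *)
Record symTensorCat (K : fieldType) := SymTensorCat {
  st_ab :> abCat K;
  ten : st_ab -> st_ab -> st_ab;
  tenm : forall X X' Y Y' : st_ab,
    (X ~> X') -> (Y ~> Y') -> (ten X Y ~> ten X' Y');
  tenm1 : forall X Y : st_ab, tenm (idm X) (idm Y) = idm (ten X Y);
  tenm_cmp : forall (X X' X'' Y Y' Y'' : st_ab)
      (f' : X' ~> X'') (f : X ~> X') (g' : Y' ~> Y'') (g : Y ~> Y'),
    tenm (f' \o f) (g' \o g) = tenm f' g' \o tenm f g;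
  tenmDl : forall (X X' Y Y' : st_ab) (a : K) (f1 f2 : X ~> X') (g : Y ~> Y'),
    tenm (a *: f1 + f2) g = a *: tenm f1 g + tenm f2 g;
  tenmDr : forall (X X' Y Y' : st_ab) (a : K) (f : X ~> X') (g1 g2 : Y ~> Y'),
    tenm f (a *: g1 + g2) = a *: tenm f g1 + tenm f g2;
  ten_kerl : forall (X Z Y Y' : st_ab) (f : Y ~> Y') (i : Z ~> Y),
    is_kernel f i -> is_kernel (tenm (idm X) f) (tenm (idm X) i);
  ten_kerr : forall (X Z Y Y' : st_ab) (f : Y ~> Y') (i : Z ~> Y),
    is_kernel f i -> is_kernel (tenm f (idm X)) (tenm i (idm X));
  ten_cokl : forall (X Z Y Y' : st_ab) (f : Y ~> Y') (p : Y' ~> Z),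
    is_cokernel f p -> is_cokernel (tenm (idm X) f) (tenm (idm X) p);
  ten_cokr : forall (X Z Y Y' : st_ab) (f : Y ~> Y') (p : Y' ~> Z),
    is_cokernel f p -> is_cokernel (tenm f (idm X)) (tenm p (idm X));
  tone : st_ab;
  tassoc : forall X Y Z : st_ab, ten (ten X Y) Z ~> ten X (ten Y Z);
  tlunit : forall X : st_ab, ten tone X ~> X;
  trunit : forall X : st_ab, ten X tone ~> X;
  tsym : forall X Y : st_ab, ten X Y ~> ten Y X;
  tassoc_iso : forall X Y Z, is_iso (tassoc X Y Z);
  tlunit_iso : forall X, is_iso (tlunit X);
  trunit_iso : forall X, is_iso (trunit X);
  tassoc_nat : forall (X X' Y Y' Z Z' : st_ab)
      (f : X ~> X') (g : Y ~> Y') (h : Z ~> Z'),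
    tassoc X' Y' Z' \o tenm (tenm f g) h = tenm f (tenm g h) \o tassoc X Y Z;
  tlunit_nat : forall (X X' : st_ab) (f : X ~> X'),
    tlunit X' \o tenm (idm tone) f = f \o tlunit X;
  trunit_nat : forall (X X' : st_ab) (f : X ~> X'),
    trunit X' \o tenm f (idm tone) = f \o trunit X;
  tsym_nat : forall (X X' Y Y' : st_ab) (f : X ~> X') (g : Y ~> Y'),
    tsym X' Y' \o tenm f g = tenm g f \o tsym X Y;
  pentagon : forall W X Y Z : st_ab,
    tassoc W X (ten Y Z) \o tassoc (ten W X) Y Z =
    tenm (idm W) (tassoc X Y Z)
      \o (tassoc W (ten X Y) Z \o tenm (tassoc W X Y) (idm Z));
  triangle : forall X Y : st_ab,
    tenm (idm X) (tlunit Y) \o tassoc X tone Y = tenm (trunit X) (idm Y);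
  tsymK : forall X Y : st_ab, tsym Y X \o tsym X Y = idm (ten X Y);
  hexagon : forall X Y Z : st_ab,
    tassoc Y Z X \o (tsym X (ten Y Z) \o tassoc X Y Z) =
    tenm (idm Y) (tsym X Z)
      \o (tassoc Y X Z \o tenm (tsym X Y) (idm Z))
}.
Arguments ten {K s}.
Arguments tenm {K s X X' Y Y'}.
Arguments tone {K s}.
Arguments tassoc {K s}.
Arguments tlunit {K s}.
Arguments trunit {K s}.
Arguments tsym {K s}.
Notation "X \ox Y" := (ten X Y) : cat_scope.
Notation "f \oxm g" := (tenm f g) : cat_scope.

(* An ambient category for the infinite direct sum [T(V)]: a fully faithful exact
   K-linear symmetric (strong) monoidal functor [C -> D].  The two intended cases
   are [D = C] with the identity (see [tens_emb_id]) and [D] the ind-completion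
   of [C] with its canonical embedding. *)
Record tensEmb (K : fieldType) (C D : symTensorCat K) := TensEmb {
  emb :> C -> D;
  embm : forall X Y : C, {linear (X ~> Y) -> (emb X ~> emb Y)};
  embm1 : forall X : C, embm X X (idm X) = idm (emb X);
  embm_cmp : forall (X Y Z : C) (g : Y ~> Z) (f : X ~> Y),
    embm X Z (g \o f) = embm Y Z g \o embm X Y f;
  embm_bij : forall X Y : C, bijective (embm X Y);
  emb_ker : forall (Z X Y : C) (f : X ~> Y) (i : Z ~> X),
    is_kernel f i -> is_kernel (embm X Y f) (embm Z X i);
  emb_cok : forall (X Y Z : C) (f : X ~> Y) (p : Y ~> Z),
    is_cokernel f p -> is_cokernel (embm X Y f) (embm Y Z p);
  embT : forall X Y : C, emb X \ox emb Y ~> emb (X \ox Y);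
  embT_iso : forall X Y, is_iso (embT X Y);
  embT_nat : forall (X X' Y Y' : C) (f : X ~> X') (g : Y ~> Y'),
    embT X' Y' \o (embm X X' f \oxm embm Y Y' g)
    = embm _ _ (f \oxm g) \o embT X Y;
  emb1 : tone ~> emb tone;
  emb1_iso : is_iso emb1;
  emb_assoc : forall X Y Z : C,
    embm _ _ (tassoc X Y Z)
      \o (embT (X \ox Y) Z \o (embT X Y \oxm idm (emb Z))) =
    embT X (Y \ox Z)
      \o ((idm (emb X) \oxm embT Y Z) \o tassoc (emb X) (emb Y) (emb Z));
  emb_lunit : forall X : C,
    embm _ _ (tlunit X) \o (embT tone X \o (emb1 \oxm idm (emb X)))
    = tlunit (emb X);
  emb_runit : forall X : C,
    embm _ _ (trunit X) \o (embT X tone \o (idm (emb X) \oxm emb1))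
    = trunit (emb X);
  emb_sym : forall X Y : C,
    embm _ _ (tsym X Y) \o embT X Y = embT Y X \o tsym (emb X) (emb Y)
}.

Section EmbId.
Variables (K : fieldType) (C : symTensorCat K).

Lemma is_iso_idm (X : C) : is_iso (idm X).
Proof. by exists (idm X); rewrite cmp1m. Qed.

Definition tens_emb_id : tensEmb C C.
Proof.
apply: (@TensEmb K C C (fun X => X) (fun X Y => idfun)
  _ _ _ _ _ (fun X Y => idm _) _ _ (idm _)) => //=; intros;
  rewrite ?tenm1 ?cmp1m ?cmpm1 //; try exact: is_iso_idm.
by exists idfun.
Defined.

End EmbId.


Section CmpTheory.
Variables (K : fieldType) (C : linCat K).
Implicit Types X Y Z : C.

Lemma cmpm0 X Y Z (g : Y ~> Z) : g \o (0 : X ~> Y) = 0.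
Proof.
by have := cmpDr (-1) g (0 : X ~> Y) 0; rewrite scaler0 addr0 scaleN1r addNr.
Qed.

Lemma cmp0m X Y Z (f : X ~> Y) : (0 : Y ~> Z) \o f = 0.
Proof.
by have := cmpDl (-1) (0 : Y ~> Z) 0 f; rewrite scaler0 addr0 scaleN1r addNr.
Qed.

Lemma kernel_mono Z X Y (f : X ~> Y) (i : Z ~> X) : is_kernel f i -> is_mono i.
Proof.
move=> [fi0 ifP] W g h eq_gh.
have [|u [_ uP]] := ifP W (i \o g); first by rewrite cmpA fi0 cmp0m.
by rewrite -(uP g) // -(uP h).
Qed.

Lemma mono_idm X : is_mono (idm X).
Proof. by move=> Z g h; rewrite !cmp1m. Qed.

End CmpTheory.

Section Subobjects.
Variables (K : fieldType) (C : abCat K).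
Implicit Types X Y Z : C.

Record subobj X := Subobj {
  sdom :> C;
  sinc : sdom ~> X;
  sinc_mono : is_mono sinc
}.
Arguments sinc {X}.

Definition factors X Y (f : Y ~> X) (S : subobj X) : Prop :=
  exists h : Y ~> S, sinc S \o h = f.

Definition sub_le X (S T : subobj X) : Prop := factors (sinc S) T.

Definition sub_eq X (S T : subobj X) : Prop := sub_le S T /\ sub_le T S.

Definition sub_full X : subobj X := Subobj (@mono_idm K C X).

Definition image X Y (f : X ~> Y) : subobj Y :=
  Subobj (kernel_mono (kerP (cokm f))).

(* The unique corestriction to [S] of a morphism factoring through [S]. *)
Definition corestr X Y (f : Y ~> X) (S : subobj X) (fS : factors f S) : Y ~> S :=
  projT1 (cid fS).

Lemma corestrE X Y (f : Y ~> X) (S : subobj X) (fS : factors f S) :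
  sinc S \o corestr fS = f.
Proof. exact: projT2 (cid fS). Qed.

Lemma factors_full X Y (f : Y ~> X) : factors f (sub_full X).
Proof. by exists f; rewrite cmp1m. Qed.

Lemma factors_image X Y (f : X ~> Y) : factors f (image f).
Proof.
have [_ kP] := kerP (cokm f); have [cf0 _] := cokP f.
by have [h [hE _]] := kP _ _ cf0; exists h.
Qed.

Lemma image_min X Y (f : X ~> Y) (T : subobj Y) :
  factors f T -> sub_le (image f) T.
Proof.
case=> h hE; have [cT0 TP] := mono_normal (@sinc_mono _ T).
have [_ cP] := cokP f.
have [|u [uE _]] := cP _ (cokm (sinc T)).
  by rewrite -hE cmpA cT0 cmp0m.
have [k0 _] := kerP (cokm f).
have [|v [vE _]] := TP _ (kerm (cokm f)); first by rewrite -uE -cmpA k0 cmpm0.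
by exists v.
Qed.

End Subobjects.
Arguments sinc {K C X}.

Section TensorPowers.
Variables (K : fieldType) (C : symTensorCat K).

Fixpoint tpow (V : C) (n : nat) : C :=
  if n is m.+1 then V \ox tpow V m else tone.

(* Concatenation, the component V^i (x) V^j -> V^(i+j) of the product of T(V). *)
Fixpoint tcat (V : C) (i j : nat) : tpow V i \ox tpow V j ~> tpow V (i + j) :=
  match i return tpow V i \ox tpow V j ~> tpow V (i + j) with
  | 0 => tlunit (tpow V j)
  | m.+1 => (idm V \oxm tcat V m j) \o tassoc V (tpow V m) (tpow V j)
  end.

(* The underlying object of T(V): a direct sum of all tensor powers over which
   the tensor product distributes. *)
Record tensorAlg (V : C) := TensorAlg {
  ta_ob :> C;
  ta_in : forall n, tpow V n ~> ta_ob;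
  ta_sum : is_coproduct ta_in;
  ta_suml : forall X : C, is_coproduct (fun n => idm X \oxm ta_in n);
  ta_sumr : forall X : C, is_coproduct (fun n => ta_in n \oxm idm X)
}.

End TensorPowers.
Arguments ta_in {K C V}.


Section TensorAlgebraProduct.
Variables (K : fieldType) (C : symTensorCat K) (V : C) (A : tensorAlg V).

Lemma ta_mul_ex : exists m : A \ox A ~> A, forall i j,
  m \o (ta_in A i \oxm ta_in A j) = ta_in A (i + j) \o tcat V i j.
Proof.
have row i : exists g : tpow V i \ox A ~> A, forall j,
    g \o (idm (tpow V i) \oxm ta_in A j) = ta_in A (i + j) \o tcat V i j.
  have [g [gE _]] :=
    ta_suml A (X := tpow V i) (fun j => ta_in A (i + j) \o tcat V i j).
  by exists g.
have [m [mE _]] := ta_sumr A (X := A) (fun i => projT1 (cid (row i))).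
exists m => i j; rewrite -(projT2 (cid (row i)) j) -mE -cmpA -tenm_cmp.
by rewrite cmpm1 cmp1m.
Qed.

Definition ta_mul : A \ox A ~> A := projT1 (cid ta_mul_ex).

Lemma ta_mulE i j :
  ta_mul \o (ta_in A i \oxm ta_in A j) = ta_in A (i + j) \o tcat V i j.
Proof. exact: projT2 (cid ta_mul_ex) i j. Qed.

(* The part of degree at most n, as a morphism into T(V). *)
Fixpoint tle (n : nat) : C :=
  if n is m.+1 then tle m \bip tpow V m.+1 else tpow V 0.

Fixpoint tle_in (n : nat) : tle n ~> A :=
  match n return tle n ~> A with
  | 0 => ta_in A 0
  | m.+1 => (tle_in m \o bpr1) + (ta_in A m.+1 \o bpr2)
  end.

End TensorAlgebraProduct.
Arguments ta_mul {K C V}.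
Arguments tle {K C}.
Arguments tle_in {K C V}.

Section LowerCentralSeries.
Variables (K : fieldType) (C : symTensorCat K) (V : C) (A : tensorAlg V).

Definition comm : A \ox A ~> A := ta_mul A \o (idm (A \ox A) - tsym A A).

Definition sub_comm (S T : subobj A) : subobj A :=
  image (comm \o (sinc S \oxm sinc T)).

(* Indexed from 1: [lcs 1 = A] and [lcs i.+1 = [A, lcs i]] for [1 <= i];
   [lcs 0 = A] is a dummy value. *)
Definition lcs (i : nat) : subobj A :=
  iter i.-1 (sub_comm (sub_full A)) (sub_full A).

Lemma sub_commS (S T T' : subobj A) :
  sub_le T T' -> sub_le (sub_comm S T) (sub_comm S T').
Proof.
case=> h hE; apply: image_min.
have [u uE] := factors_image (comm \o (sinc S \oxm sinc T')).
exists (u \o (idm S \oxm h)); rewrite cmpA uE -cmpA -tenm_cmp.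
by rewrite cmpm1 hE.
Qed.

Lemma lcs_decr i : sub_le (lcs i.+1) (lcs i).
Proof.
case: i => [|i]; first exact: factors_full.
elim: i => [|i IHi]; [exact: factors_full | exact: sub_commS].
Qed.

Lemma ad_factors k : factors (comm \o (idm A \oxm sinc (lcs k.-1))) (lcs k).
Proof. by case: k => [|[|k]]; [exact: factors_full .. | exact: factors_image]. Qed.

Lemma ad_factorsS k :
  factors (comm \o (idm A \oxm sinc (lcs k.-1.+1))) (lcs k.+1).
Proof. by case: k => [|k]; [exact: factors_full | exact: (ad_factors k.+2)]. Qed.

Definition lcs_inc i : lcs i.+1 ~> lcs i := corestr (lcs_decr i).

Definition lcs_ad k : A \ox lcs k.-1 ~> lcs k := corestr (ad_factors k).

Definition lcq (i : nat) : C := cok (lcs_inc i).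

Definition lcq_pi i : lcs i ~> lcq i := cokm (lcs_inc i).

Lemma lcq_ad_ex k : exists b : A \ox lcq k.-1 ~> lcq k,
  b \o (idm A \oxm lcq_pi k.-1) = lcq_pi k \o lcs_ad k.
Proof.
have [pi0 _] := cokP (lcs_inc k).
have [_ cP] := ten_cokl A (cokP (lcs_inc k.-1)).
have [|b [bE _]] := cP _ (lcq_pi k \o lcs_ad k); last by exists b.
rewrite -cmpA.
suff -> : cmp (lcs_ad k) (idm A \oxm lcs_inc k.-1)
        = lcs_inc k \o corestr (ad_factorsS k) by rewrite cmpA pi0 cmp0m.
apply: (@sinc_mono _ _ _ (lcs k)).
rewrite !cmpA !corestrE -cmpA -tenm_cmp cmpm1.
by rewrite /lcs_inc corestrE.
Qed.

(* The morphism A (x) B_(k-1) -> B_k induced by the commutator; it is unique,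
   [idm A \oxm lcq_pi k.-1] being a cokernel. *)
Definition lcq_ad k : A \ox lcq k.-1 ~> lcq k := projT1 (cid (lcq_ad_ex k)).

Lemma lcq_adE k : lcq_ad k \o (idm A \oxm lcq_pi k.-1) = lcq_pi k \o lcs_ad k.
Proof. exact: projT2 (cid (lcq_ad_ex k)). Qed.

(* [A_(<= n), B_(k-1)] as a subobject of B_k. *)
Definition lcq_ad_le (n k : nat) : subobj (lcq k) :=
  image (lcq_ad k \o (tle_in A n \oxm idm (lcq k.-1))).

End LowerCentralSeries.
Arguments comm {K C V}.
Arguments lcs {K C V}.
Arguments lcq {K C V}.
Arguments lcq_ad {K C V}.
Arguments lcq_ad_le {K C V}.

(* Main.v *)
(** Everything happens in D, on A = T(EV).  For objects X_i with maps
    x_i : X_i ~> A, multilinear noncommutative polynomials in the x_i are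
    evaluated as morphisms X_1 (x) ... (x) X_n ~> A, so that a multilinear
    identity of free associative algebras holds in every symmetric tensor
    category as soon as both sides have the same expansion into words.

    Let U = [A_(<=2), L_(k-1)] + L_(k+1).  One shows [T^n, L_(k-1)] <= U by
    induction on the degree n, writing an element of degree n >= 3 as x y z with
    x, y of degree 1; since 6xyz = Sym + Alt + commutators and
    [L_2, L_(k-1)] <= L_(k+1), the totally symmetric and the alternating part
    can be treated separately.  For the symmetric part (b in L_(k-2))

      2[a^3,[v,b]] = 3[a^2,[av+va,b]] - 6[a,[ava,b]]
                     + 3[a,[a,[v,[a,b]]]] - [a,[a,[a,[v,b]]]],

    polarized in a, lowers the degree of the first entry.  For the alternating
    part one needs the theorem of Feigin-Shoikhet and Bapat-Jordan that
    [A, A L_j] <= L_(j+1) for odd j.  For odd k it gives [A, A L_(k-2)] <= L_(k-1),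
    and another identity lowers the degree.  For even k one may take v in A_(<=2)
    by the case k-1, and b in [A, L_(k-3)] with k-3 odd, so that
    [A, L_2 b] <= L_(k-1); a third identity then expresses [xyz,[v,b]] by
    brackets whose first entry is v or one of x, y, z. *)

From mathcomp Require Import all_boot all_order all_algebra boolp.
Require Import Defs.
Set Implicit Arguments.
Unset Strict Implicit.
Unset Printing Implicit Defensive.
Import GRing.Theory.
Local Open Scope ring_scope.
Local Open Scope cat_scope.

(** * Linear and symmetric tensor categories *)

Section LinearCategories.
Variables (K : fieldType) (C : linCat K).
Implicit Types X Y Z W : C.

Lemma cmpmD X Y Z (g : Y ~> Z) (f1 f2 : X ~> Y) :
  g \o (f1 + f2) = (g \o f1) + (g \o f2).
Proof. by have := cmpDr 1 g f1 f2; rewrite !scale1r. Qed.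

Lemma cmpDm X Y Z (g1 g2 : Y ~> Z) (f : X ~> Y) :
  (g1 + g2) \o f = (g1 \o f) + (g2 \o f).
Proof. by have := cmpDl 1 g1 g2 f; rewrite !scale1r. Qed.

Lemma cmpmZ X Y Z (a : K) (g : Y ~> Z) (f : X ~> Y) : g \o (a *: f) = a *: (g \o f).
Proof. by have := cmpDr a g f 0; rewrite cmpm0 !addr0. Qed.

Lemma cmpmN X Y Z (g : Y ~> Z) (f : X ~> Y) : g \o (- f) = - (g \o f).
Proof. by rewrite -scaleN1r cmpmZ scaleN1r. Qed.

Lemma cmpNm X Y Z (g : Y ~> Z) (f : X ~> Y) : (- g) \o f = - (g \o f).
Proof. by apply/esym/addr0_eq; rewrite -cmpDm subrr cmp0m. Qed.

Lemma cmpmB X Y Z (g : Y ~> Z) (f1 f2 : X ~> Y) :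
  g \o (f1 - f2) = (g \o f1) - (g \o f2).
Proof. by rewrite cmpmD cmpmN. Qed.

Lemma cmpBm X Y Z (g1 g2 : Y ~> Z) (f : X ~> Y) :
  (g1 - g2) \o f = (g1 \o f) - (g2 \o f).
Proof. by rewrite cmpDm cmpNm. Qed.

Lemma cmpm_sum I (r : seq I) X Y Z (g : Y ~> Z) (F : I -> (X ~> Y)) :
  g \o (\sum_(i <- r) F i) = \sum_(i <- r) (g \o F i).
Proof.
by elim: r => [|i r IHr]; rewrite ?big_nil ?cmpm0 // !big_cons cmpmD IHr.
Qed.

Lemma cmp_summ I (r : seq I) X Y Z (F : I -> (Y ~> Z)) (f : X ~> Y) :
  (\sum_(i <- r) F i) \o f = \sum_(i <- r) (F i \o f).
Proof.
by elim: r => [|i r IHr]; rewrite ?big_nil ?cmp0m // !big_cons cmpDm IHr.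
Qed.

(* Turns an equation into a rewrite rule for right-nested composites. *)
Lemma cmp2 X Y Z T (g : Y ~> Z) (f : X ~> Y) (e : X ~> Z) :
  g \o f = e -> forall u : T ~> X, g \o (f \o u) = e \o u.
Proof. by move=> <- u; rewrite cmpA. Qed.

Lemma cmp3 W X Y Z T (h : Y ~> Z) (g : X ~> Y) (f : W ~> X) (e : W ~> Z) :
  h \o (g \o f) = e -> forall u : T ~> W, h \o (g \o (f \o u)) = e \o u.
Proof. by move=> <- u; rewrite !cmpA. Qed.

Lemma is_iso_cmp X Y Z (g : Y ~> Z) (f : X ~> Y) :
  is_iso g -> is_iso f -> is_iso (g \o f).
Proof.
move=> [g' [gK Kg]] [f' [fK Kf]]; exists (f' \o g'); split.
  by rewrite -cmpA (cmp2 gK) cmp1m.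
by rewrite -cmpA (cmp2 Kf) cmp1m.
Qed.

Lemma iso_epi X Y (f : X ~> Y) : is_iso f -> is_epi f.
Proof.
by move=> [f' [_ Kf]] Z g h E; rewrite -(cmpm1 g) -(cmpm1 h) -Kf !cmpA E.
Qed.

Definition inv X Y (f : X ~> Y) (fI : is_iso f) : Y ~> X := projT1 (cid fI).

Lemma invK X Y (f : X ~> Y) (fI : is_iso f) : inv fI \o f = idm X.
Proof. by case: (projT2 (cid fI)). Qed.

Lemma Kinv X Y (f : X ~> Y) (fI : is_iso f) : f \o inv fI = idm Y.
Proof. by case: (projT2 (cid fI)). Qed.

Lemma inv_iso X Y (f : X ~> Y) (fI : is_iso f) : is_iso (inv fI).
Proof. by exists f; rewrite Kinv invK. Qed.

Lemma cokernel_epi X Y Z (f : X ~> Y) (p : Y ~> Z) : is_cokernel f p -> is_epi p.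
Proof.
move=> [pf0 pP] W g h eq_gh.
have [|u [_ uP]] := pP W (g \o p); first by rewrite -cmpA pf0 cmpm0.
by rewrite -(uP g) // -(uP h).
Qed.

Lemma coproduct_ext (F : nat -> C) S (i : forall n, F n ~> S) Y (g h : S ~> Y) :
  is_coproduct i -> (forall n, g \o i n = h \o i n) -> g = h.
Proof.
move=> iP E; have [u [_ uP]] := iP Y (fun n => h \o i n).
by rewrite -(uP g) // -(uP h).
Qed.

End LinearCategories.

(** * Coherence for units and for transpositions of adjacent factors *)

Section SymmetricTensorCategories.
Variables (K : fieldType) (C : symTensorCat K).
Implicit Types X Y Z W : C.

Lemma tenDm X X' Y Y' (f1 f2 : X ~> X') (g : Y ~> Y') :
  (f1 + f2) \oxm g = f1 \oxm g + f2 \oxm g.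
Proof. by have := tenmDl 1 f1 f2 g; rewrite !scale1r. Qed.

Lemma tenmD X X' Y Y' (f : X ~> X') (g1 g2 : Y ~> Y') :
  f \oxm (g1 + g2) = f \oxm g1 + f \oxm g2.
Proof. by have := tenmDr 1 f g1 g2; rewrite !scale1r. Qed.

Lemma ten0m X X' Y Y' (g : Y ~> Y') : (0 : X ~> X') \oxm g = 0.
Proof. by apply: (addIr (0 \oxm g)); rewrite -tenDm !add0r. Qed.

Lemma tenm0 X X' Y Y' (f : X ~> X') : f \oxm (0 : Y ~> Y') = 0.
Proof. by apply: (addIr (f \oxm 0)); rewrite -tenmD !add0r. Qed.

Lemma tenNm X X' Y Y' (f : X ~> X') (g : Y ~> Y') : (- f) \oxm g = - (f \oxm g).
Proof. by apply/esym/addr0_eq; rewrite -tenDm subrr ten0m. Qed.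

Lemma tenmN X X' Y Y' (f : X ~> X') (g : Y ~> Y') : f \oxm (- g) = - (f \oxm g).
Proof. by apply/esym/addr0_eq; rewrite -tenmD subrr tenm0. Qed.

Lemma tenm_sum I (r : seq I) X X' Y Y' (f : X ~> X') (F : I -> (Y ~> Y')) :
  f \oxm (\sum_(i <- r) F i) = \sum_(i <- r) (f \oxm F i).
Proof.
by elim: r => [|i r IHr]; rewrite ?big_nil ?tenm0 // !big_cons tenmD IHr.
Qed.

Lemma ten1_cmp X Y Y' Y'' (g' : Y' ~> Y'') (g : Y ~> Y') :
  idm X \oxm (g' \o g) = (idm X \oxm g') \o (idm X \oxm g).
Proof. by rewrite -tenm_cmp cmpm1. Qed.

Lemma tencmp1 X X' X'' Y (f' : X' ~> X'') (f : X ~> X') :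
  (f' \o f) \oxm idm Y = (f' \oxm idm Y) \o (f \oxm idm Y).
Proof. by rewrite -tenm_cmp cmpm1. Qed.

Lemma ten_swap X X' Y Y' (f : X ~> X') (g : Y ~> Y') :
  (idm X' \oxm g) \o (f \oxm idm Y) = (f \oxm idm Y') \o (idm X \oxm g).
Proof. by rewrite -!tenm_cmp !cmp1m !cmpm1. Qed.

Lemma ten_split X X' Y Y' (f : X ~> X') (g : Y ~> Y') :
  f \oxm g = (idm X' \oxm g) \o (f \oxm idm Y).
Proof. by rewrite -tenm_cmp cmp1m cmpm1. Qed.

Lemma ten_iso X X' Y Y' (f : X ~> X') (g : Y ~> Y') :
  is_iso f -> is_iso g -> is_iso (f \oxm g).
Proof.
move=> [f' [fK Kf]] [g' [gK Kg]]; exists (f' \oxm g').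
by rewrite -!tenm_cmp fK Kf gK Kg !tenm1.
Qed.

Definition tassoc' X Y Z : X \ox (Y \ox Z) ~> (X \ox Y) \ox Z :=
  inv (tassoc_iso X Y Z).

Lemma tassocK X Y Z : tassoc' X Y Z \o tassoc X Y Z = idm _.
Proof. exact: invK. Qed.

Lemma Ktassoc X Y Z : tassoc X Y Z \o tassoc' X Y Z = idm _.
Proof. exact: Kinv. Qed.

Lemma tassoc'_nat X X' Y Y' Z Z' (f : X ~> X') (g : Y ~> Y') (h : Z ~> Z') :
  tassoc' X' Y' Z' \o (f \oxm (g \oxm h)) = ((f \oxm g) \oxm h) \o tassoc' X Y Z.
Proof.
apply: (iso_epi (tassoc_iso X Y Z)); rewrite -!cmpA tassocK cmpm1.
by rewrite -tassoc_nat (cmp2 (tassocK _ _ _)) cmp1m.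
Qed.

Lemma ten_tone_inj X Y (f g : X ~> Y) : f \oxm idm tone = g \oxm idm tone -> f = g.
Proof.
move=> E; apply: (iso_epi (trunit_iso X)).
by rewrite -!trunit_nat E.
Qed.

Lemma tone_ten_inj X Y (f g : X ~> Y) : idm tone \oxm f = idm tone \oxm g -> f = g.
Proof.
move=> E; apply: (iso_epi (tlunit_iso X)).
by rewrite -!tlunit_nat E.
Qed.

(** Kelly's argument: tensoring with the unit is faithful, and after it the claim follows from the
    pentagon and from [triangle], where the unit stands in the middle. *)
Lemma tlunit_tassoc X Y :
  tlunit (X \ox Y) \o tassoc tone X Y = tlunit X \oxm idm Y.
Proof.
apply: tone_ten_inj.
apply: (iso_epi (tassoc_iso tone (tone \ox X) Y)).
apply: (iso_epi (ten_iso (tassoc_iso tone tone X) (is_iso_idm Y))).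
rewrite ten1_cmp -!cmpA -pentagon (cmp2 (triangle _ _)) -(tenm1 X Y).
by rewrite -tassoc_nat (cmp2 (esym (tassoc_nat _ _ _))) -cmpA -tencmp1 triangle.
Qed.

(* [tswap X Y W] exchanges the first two factors of [X \ox (Y \ox W)]. *)
Definition tswap X Y W : X \ox (Y \ox W) ~> Y \ox (X \ox W) :=
  locked (tassoc Y X W \o ((tsym X Y \oxm idm W) \o tassoc' X Y W)).

Lemma tswap_nat X X' Y Y' W W' (f : X ~> X') (g : Y ~> Y') (h : W ~> W') :
  tswap X' Y' W' \o (f \oxm (g \oxm h)) = (g \oxm (f \oxm h)) \o tswap X Y W.
Proof.
rewrite /tswap -!lock -!cmpA tassoc'_nat (cmpA _ (_ \oxm h)).
rewrite -tenm_cmp tsym_nat cmp1m.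
by rewrite -[h in LHS]cmpm1 tenm_cmp -!cmpA (cmp2 (tassoc_nat _ _ _)) -!cmpA.
Qed.

Lemma tswapK X Y W : tswap Y X W \o tswap X Y W = idm _.
Proof.
rewrite /tswap -!lock -!cmpA (cmp2 (tassocK _ _ _)) cmp1m.
by rewrite (cmpA _ (tsym X Y \oxm _)) -tencmp1 tsymK tenm1 cmp1m Ktassoc.
Qed.

Lemma tswap_iso X Y W : is_iso (tswap X Y W).
Proof. by exists (tswap Y X W); rewrite !tswapK. Qed.

Lemma tswap_tassoc X Y W :
  tswap X Y W \o tassoc X Y W = tassoc Y X W \o (tsym X Y \oxm idm W).
Proof. by rewrite /tswap -!lock -!cmpA tassocK cmpm1. Qed.

(** The hexagon with a passive tail [W]; the pentagon absorbs the associators. *)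
Lemma tswap_ten X Y Z W :
  tassoc Y Z (X \ox W) \o tswap X (Y \ox Z) W =
  (idm Y \oxm tswap X Z W) \o (tswap X Y (Z \ox W) \o (idm X \oxm tassoc Y Z W)).
Proof.
apply: (iso_epi (tassoc_iso X (Y \ox Z) W)).
apply: (iso_epi (ten_iso (tassoc_iso X Y Z) (is_iso_idm W))).
rewrite -!cmpA (cmp2 (tswap_tassoc _ _ _)) -!cmpA.
rewrite -(pentagon X Y Z W) (cmp2 (tswap_tassoc _ _ _)) -!cmpA.
rewrite (cmp2 (pentagon _ _ _ _)) -!cmpA -tencmp1 -tencmp1.
rewrite hexagon !tencmp1 (cmp2 (tassoc_nat _ _ _)) -!cmpA.
rewrite -(tenm1 Z W) -(tassoc_nat (tsym X Y)).
rewrite (cmp2 (pentagon _ _ _ _)) -!cmpA (cmp2 (esym (ten1_cmp Y (tswap _ _ _) _))).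
by rewrite tswap_tassoc ten1_cmp -!cmpA.
Qed.

(** Yang-Baxter: by [tswap_ten] both sides move [X] past a product of [Y] and [Z], and naturality
    slides [tsym Y Z] through. *)
Lemma tswap_braid X Y Z W :
  (idm Z \oxm tswap X Y W) \o (tswap X Z (Y \ox W) \o (idm X \oxm tswap Y Z W)) =
  tswap Y Z (X \ox W) \o ((idm Y \oxm tswap X Z W) \o tswap X Y (Z \ox W)).
Proof.
apply: (iso_epi (ten_iso (is_iso_idm X) (tassoc_iso Y Z W))).
rewrite -!cmpA -ten1_cmp tswap_tassoc ten1_cmp.
rewrite -tswap_ten (cmpA (idm Z \oxm _)) (cmpA _ _ (idm X \oxm (_ \oxm _))).
rewrite -(cmpA (idm Z \oxm _)).
rewrite -tswap_ten -cmpA tswap_nat tenm1 (cmp2 (tswap_tassoc _ _ _)).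
by rewrite -!cmpA.
Qed.

End SymmetricTensorCategories.

(** * Shuffles *)

Fixpoint splits (K P Q : bitseq) : bool :=
  match K, P, Q with
  | [::], [::], [::] => true
  | k :: K', p :: P', q :: Q' => [&& k == p || q, ~~ (p && q) & splits K' P' Q']
  | _, _, _ => false
  end.

Lemma splits_map I (s : seq I) (f g h : pred I) :
  splits (map f s) (map g s) (map h s) =
  all (fun i => (f i == g i || h i) && ~~ (g i && h i)) s.
Proof. by elim: s => //= i s ->; rewrite andbA. Qed.

Section Shuffles.
Variables (F : fieldType) (C : symTensorCat F) (T : Type) (o : T -> C).
Implicit Types (G : seq T) (K P Q : bitseq) (X Z W : C).

(* [mten G K Z] is [X1 \ox (X2 \ox ... \ox Z)], where the [Xi] are the objects
   of [G] selected by the mask [K].  Carrying the tail [Z] along makes the empty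
   selection the identity functor, so that no unit isomorphisms are needed. *)
Fixpoint mten G K Z : C :=
  match G, K with
  | x :: G', true :: K' => o x \ox mten G' K' Z
  | x :: G', false :: K' => mten G' K' Z
  | _, _ => Z
  end.

Fixpoint mtenm G K Z W (f : Z ~> W) : mten G K Z ~> mten G K W :=
  match G, K with
  | x :: G', true :: K' => idm (o x) \oxm mtenm G' K' f
  | x :: G', false :: K' => mtenm G' K' f
  | _, _ => f
  end.

Fixpoint pass X G P Z : X \ox mten G P Z ~> mten G P (X \ox Z) :=
  match G, P with
  | y :: G', true :: P' => (idm (o y) \oxm pass X G' P' Z) \o tswap X (o y) _
  | y :: G', false :: P' => pass X G' P' Z
  | _, _ => idm (X \ox Z)
  end.

(* The junk value [0] is taken unless [K] is the disjoint union of [P] and [Q]. *)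
Fixpoint shuf G K P Q Z : mten G K Z ~> mten G P (mten G Q Z) :=
  match G with
  | [::] => idm Z
  | x :: G' =>
    match K, P, Q return mten (x :: G') K Z
        ~> mten (x :: G') P (mten (x :: G') Q Z) with
    | true :: K', true :: P', false :: Q' => idm (o x) \oxm shuf G' K' P' Q' Z
    | true :: K', false :: P', true :: Q' =>
        pass (o x) G' P' (mten G' Q' Z) \o (idm (o x) \oxm shuf G' K' P' Q' Z)
    | false :: K', false :: P', false :: Q' => shuf G' K' P' Q' Z
    | [::], [::], [::] => idm Z
    | _, _, _ => 0
    end
  end.

(** Two independent sequences are allowed so that an induction can run over one block while the
    other stays fixed; [shufC] takes them equal. *)
Fixpoint mswap G Q G' P Z : mten G Q (mten G' P Z) ~> mten G' P (mten G Q Z) :=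
  match G, Q with
  | y :: G1, true :: Q1 => pass (o y) G' P (mten G1 Q1 Z)
      \o (idm (o y) \oxm mswap G1 Q1 G' P Z)
  | y :: G1, false :: Q1 => mswap G1 Q1 G' P Z
  | _, _ => idm (mten G' P Z)
  end.

Lemma mtenm_cmp G K X Z W (g : Z ~> W) (f : X ~> Z) :
  mtenm G K (g \o f) = mtenm G K g \o mtenm G K f.
Proof. by elim: G K => [|x G IHG] [|[] K] //=; rewrite IHG ?ten1_cmp. Qed.

Lemma pass_nat X G P Z W (f : Z ~> W) :
  pass X G P W \o (idm X \oxm mtenm G P f)
  = mtenm G P (idm X \oxm f) \o pass X G P Z.
Proof.
elim: G P => [|y G IHG] [|[] P] //=; rewrite ?cmp1m ?cmpm1 //.
by rewrite -cmpA tswap_nat cmpA -ten1_cmp IHG ten1_cmp -cmpA.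
Qed.

Lemma pass_iso X G P Z : is_iso (pass X G P Z).
Proof.
elim: G P => [|y G IHG] [|[] P] //=; try exact: is_iso_idm.
by apply: is_iso_cmp (tswap_iso _ _ _); apply: ten_iso => //; exact: is_iso_idm.
Qed.

Lemma pass_tswap X Y G P W :
  mtenm G P (tswap X Y W) \o (pass X G P (Y \ox W) \o (idm X \oxm pass Y G P W))
  = pass Y G P (X \ox W) \o ((idm Y \oxm pass X G P W) \o tswap X Y (mten G P W)).
Proof.
elim: G P => [|z G IHG] [|[] P] //=; rewrite ?tenm1 ?cmp1m ?cmpm1 //.
rewrite !ten1_cmp -!cmpA (cmp2 (tswap_nat _ _ _)) -!cmpA.
rewrite (cmp2 (tswap_nat _ _ _)) -!cmpA -tswap_braid.
have := congr1 (tenm (idm (o z))) (IHG P); rewrite !ten1_cmp => E.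
by rewrite (cmp3 E) -!cmpA.
Qed.

Lemma shuf_nat G K P Q Z W (f : Z ~> W) : splits K P Q ->
  shuf G K P Q W \o mtenm G K f = mtenm G P (mtenm G Q f) \o shuf G K P Q Z.
Proof.
elim: G K P Q => [|x G IHG] K P Q; first by rewrite /= cmp1m cmpm1.
case: K P Q => [|[] K] [|[] P] [|[] Q] //= KPQ;
  rewrite ?tenm1 ?cmp1m ?cmpm1 //; last exact: IHG.
  by rewrite -!ten1_cmp IHG.
by rewrite -cmpA -ten1_cmp IHG // ten1_cmp cmpA pass_nat -cmpA.
Qed.

Lemma shuf_iso G K P Q Z : splits K P Q -> is_iso (shuf G K P Q Z).
Proof.
elim: G K P Q => [|x G IHG] K P Q; first by move=> _; exact: is_iso_idm.
case: K P Q => [|[] K] [|[] P] [|[] Q] //= KPQ; try exact: is_iso_idm;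
  last exact: IHG.
  by apply: ten_iso (IHG _ _ _ KPQ); exact: is_iso_idm.
apply: is_iso_cmp; first exact: pass_iso.
by apply: ten_iso (IHG _ _ _ KPQ); exact: is_iso_idm.
Qed.

(** The braid relation enters, through [pass_tswap], when the first factor goes to the second
    block. *)
Lemma pass_shuf X G K P Q Z : splits K P Q ->
  shuf G K P Q (X \ox Z) \o pass X G K Z =
  mtenm G P (pass X G Q Z)
    \o (pass X G P (mten G Q Z) \o (idm X \oxm shuf G K P Q Z)).
Proof.
elim: G K P Q => [|x G IHG] K P Q; first by rewrite /= tenm1 !cmp1m.
case: K P Q => [|[] K] [|[] P] [|[] Q] //= KPQ;
  rewrite ?tenm1 ?cmp1m ?cmpm1 //; last exact: IHG.
  rewrite cmpA -ten1_cmp IHG // !ten1_cmp -!cmpA.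
  by rewrite tswap_nat.
rewrite -!cmpA (cmp2 (esym (ten1_cmp _ _ _))) IHG // !ten1_cmp !mtenm_cmp.
rewrite -!cmpA (cmp2 (pass_nat _ _ _ _)) -!cmpA -tswap_nat.
by rewrite (cmp3 (pass_tswap X (o x) G P (mten G Q Z))) -!cmpA.
Qed.

(** Coassociativity of splitting: the masks [P], [Q], [S] partition [K], with [M] the union of [P]
    and [Q], and [N] that of [Q] and [S]. It is what makes products of evaluations associative. *)
Lemma shufA G K M N P Q S Z :
  splits K M S -> splits M P Q -> splits K P N -> splits N Q S ->
  shuf G M P Q (mten G S Z) \o shuf G K M S Z =
  mtenm G P (shuf G N Q S Z) \o shuf G K P N Z.
Proof.
elim: G K M N P Q S => [|x G IHG] K M N P Q S; first by rewrite /= !cmp1m.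
case: K M S => [|[] K] [|[] M] [|[] S] //;
case: P Q => [|[] P] [|[] Q] //; case: N => [|[] N] //= *.
- by rewrite -!ten1_cmp (IHG _ _ N).
- by rewrite -cmpA -ten1_cmp (IHG _ _ N) // ten1_cmp cmpA pass_nat -cmpA.
- rewrite cmpA pass_shuf // -!cmpA -ten1_cmp (IHG _ _ N) // ten1_cmp mtenm_cmp.
  by rewrite (cmp2 (pass_nat _ _ _ _)) -!cmpA.
- exact: IHG.
Qed.

Lemma mswap_cons y G Q G' P Z :
  mswap G Q (y :: G') (true :: P) Z \o pass (o y) G Q (mten G' P Z)
  = idm (o y) \oxm mswap G Q G' P Z.
Proof.
elim: G Q => [|z G IHG] [|[] Q] //=; rewrite ?cmp1m ?tenm1 //.
rewrite -!cmpA (cmp2 (esym (ten1_cmp (o z) _ _))) IHG.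
by rewrite (cmp2 (tswap_nat _ _ _)) -!cmpA tswapK cmpm1 ten1_cmp.
Qed.

Lemma mswap_consf y G Q G' P Z :
  mswap G Q (y :: G') (false :: P) Z = mswap G Q G' P Z.
Proof. by elim: G Q => [|z G IHG] [|[] Q] //=; rewrite IHG. Qed.

(** Where [mswap] meets a transposition made by the shuffle, the two cancel by [tswapK]: this is
    where the braiding is a symmetry. *)
Lemma shufC G K P Q Z : splits K P Q ->
  mswap G Q G P Z \o shuf G K Q P Z = shuf G K P Q Z.
Proof.
elim: G K P Q => [|x G IHG] K P Q; first by rewrite /= cmp1m.
case: K P Q => [|[] K] [|[] P] [|[] Q] // KPQ.
- by rewrite /= cmp1m.
- rewrite [shuf _ _ _ _ _ in LHS]/= [RHS]/= cmpA mswap_cons -ten1_cmp.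
  by rewrite IHG.
- by rewrite /= mswap_consf -!cmpA -ten1_cmp IHG.
- by rewrite /= mswap_consf IHG.
Qed.

End Shuffles.

(** * Multilinear expressions *)

Inductive expr :=
  Var of nat | Mul of expr & expr | Add of expr & expr | Opp of expr.

Definition Br a b := Add (Mul a b) (Opp (Mul b a)).

(** A sum is read off its left summand; [multilinear] makes both summands agree up to order. *)
Fixpoint vars e : seq nat :=
  match e with
  | Var i => [:: i]
  | Mul a b => vars a ++ vars b
  | Add a _ => vars a
  | Opp a => vars a
  end.

Fixpoint multilinear e : bool :=
  match e with
  | Var _ => true
  | Mul a b => [&& multilinear a, multilinear b & uniq (vars a ++ vars b)]
  | Add a b => [&& multilinear a, multilinear b & perm_eq (vars a) (vars b)]
  | Opp a => multilinear a
  end.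

(* The words with coefficient 1 and those with coefficient -1, with repetitions. *)
Fixpoint expand e : seq (seq nat) * seq (seq nat) :=
  match e with
  | Var i => ([:: [:: i]], [::])
  | Mul a b =>
    let: (pa, na) := expand a in
    let: (pb, nb) := expand b in
    ([seq u ++ v | u <- pa, v <- pb] ++ [seq u ++ v | u <- na, v <- nb],
     [seq u ++ v | u <- pa, v <- nb] ++ [seq u ++ v | u <- na, v <- pb])
  | Add a b =>
    let: (pa, na) := expand a in
    let: (pb, nb) := expand b in (pa ++ pb, na ++ nb)
  | Opp a => let: (pa, na) := expand a in (na, pa)
  end.

(** Equality in the free abelian group on words: negative words change sides, so that no
    cancellation has to be computed. *)
Definition same_expansion a b : bool :=
  [&& multilinear a, multilinear b, perm_eq (vars a) (vars b)
    & perm_eq ((expand a).1 ++ (expand b).2) ((expand b).1 ++ (expand a).2)].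

Lemma vars_gt0 e : (0 < size (vars e))%N.
Proof. by elim: e => //= a IHa b _; rewrite size_cat addn_gt0 IHa. Qed.

Lemma expand_perm e : multilinear e ->
  {in (expand e).1 ++ (expand e).2, forall w, perm_eq w (vars e)}.
Proof.
elim: e => [i _ w | a IHa b IHb | a IHa b IHb | a IHa] /=.
- by rewrite mem_seq1 => /eqP->.
- case/and3P=> /IHa {}IHa /IHb {}IHb _ w; move: IHa IHb.
  case: (expand a) (expand b) => [pa na] [pb nb] /= IHa IHb.
  rewrite !mem_cat -!orbA => /or4P[] /allpairsP[[u v] [/= uP vP ->]];
  by apply: perm_cat; [apply: IHa | apply: IHb]; rewrite mem_cat ?uP ?vP ?orbT.
- case/and3P=> /IHa {}IHa /IHb {}IHb ab w; move: IHa IHb.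
  case: (expand a) (expand b) => [pa na] [pb nb] /= IHa IHb.
  rewrite !mem_cat -!orbA => /or4P[] wP;
  by [apply: IHa; rewrite mem_cat wP ?orbT
     | rewrite (perm_trans (IHb w _)) 1?perm_sym // mem_cat wP ?orbT].
- move=> /IHa {}IHa w; move: IHa; case: (expand a) => [pa na] /= IHa.
  by rewrite mem_cat orbC => wP; apply: IHa; rewrite mem_cat.
Qed.

Definition mask_of n (s : seq nat) : bitseq := [seq i \in s | i <- iota 0 n].

Lemma eq_mask_of n (s t : seq nat) : perm_eq s t -> mask_of n s = mask_of n t.
Proof. by move=> /perm_mem st; apply: eq_map => i; rewrite st. Qed.

Lemma splits_mask n (s t : seq nat) :
  uniq (s ++ t) -> splits (mask_of n (s ++ t)) (mask_of n s) (mask_of n t).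
Proof.
rewrite cat_uniq => /and3P[_ st _]; rewrite splits_map; apply/allP=> i _.
rewrite mem_cat eqxx /=; apply: contra st => /andP[si ti].
by apply/hasP; exists i.
Qed.

(** * Evaluation of multilinear expressions in an associative algebra object *)

Section Evaluation.
Variables (F : fieldType) (C : symTensorCat F) (A : C) (mu : A \ox A ~> A).
Hypothesis muA : mu \o (mu \oxm idm A) = mu \o ((idm A \oxm mu) \o tassoc A A A).
Implicit Types (X Z W : C) (K P Q : bitseq).

Definition mul_tail Z : A \ox (A \ox Z) ~> A \ox Z :=
  locked ((mu \oxm idm Z) \o tassoc' A A Z).

Lemma mul_tailE Z : mul_tail Z \o tassoc A A Z = mu \oxm idm Z.
Proof. by rewrite /mul_tail -lock -cmpA tassocK cmpm1. Qed.

Lemma mul_tail_nat Z W (f : Z ~> W) :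
  mul_tail W \o (idm A \oxm (idm A \oxm f)) = (idm A \oxm f) \o mul_tail Z.
Proof.
rewrite /mul_tail -!lock -cmpA tassoc'_nat tenm1 (cmp2 (esym (ten_swap _ _))).
by rewrite -cmpA.
Qed.

Lemma mul_tailA Z :
  mul_tail Z \o mul_tail (A \ox Z) = mul_tail Z \o (idm A \oxm mul_tail Z).
Proof.
apply: (iso_epi (tassoc_iso A A (A \ox Z))).
apply: (iso_epi (tassoc_iso (A \ox A) A Z)).
rewrite -!cmpA (cmp2 (mul_tailE _)) pentagon.
rewrite (cmp2 (esym (ten1_cmp _ _ _))) mul_tailE (cmp2 (esym (tassoc_nat _ _ _))).
rewrite -!cmpA (cmp2 (mul_tailE _)) -!tencmp1 -muA -(tenm1 A Z) -tassoc_nat.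
by rewrite (cmp2 (mul_tailE _)) -tencmp1.
Qed.

Lemma mul_tail_tswap X Z :
  tswap X A Z \o (idm X \oxm mul_tail Z)
  = mul_tail (X \ox Z) \o ((idm A \oxm tswap X A Z) \o tswap X A (A \ox Z)).
Proof.
apply: (iso_epi (ten_iso (is_iso_idm X) (tassoc_iso A A Z))).
rewrite -!cmpA -tswap_ten -ten1_cmp mul_tailE tswap_nat tenm1.
by rewrite (cmp2 (mul_tailE _)).
Qed.

Lemma mul_tailC Z :
  mul_tail Z \o tswap A A Z = ((mu \o tsym A A) \oxm idm Z) \o tassoc' A A Z.
Proof.
apply: (iso_epi (tassoc_iso A A Z)).
by rewrite -!cmpA tswap_tassoc tassocK cmpm1 (cmp2 (mul_tailE _)) tencmp1.
Qed.

Notation gen := {X : C & X ~> A}.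
Implicit Types (G : seq gen).

Local Notation mten := (@mten F C gen (@projT1 _ _)).
Local Notation mtenm := (@mtenm F C gen (@projT1 _ _)).
Local Notation shuf := (@shuf F C gen (@projT1 _ _)).
Local Notation pass := (@pass F C gen (@projT1 _ _)).

Fixpoint empty_tail G K Z : mten G K Z ~> Z :=
  match G, K with
  | x :: G', true :: K' => 0
  | x :: G', false :: K' => empty_tail G' K' Z
  | _, _ => idm Z
  end.

(* The junk value [0] is taken unless [K] selects exactly the [i]-th entry. *)
Fixpoint eval_var G K i Z : mten G K Z ~> A \ox Z :=
  match G, K with
  | x :: G', true :: K' =>
      if i is 0 then projT2 x \oxm empty_tail G' K' Z else 0
  | x :: G', false :: K' => if i is j.+1 then eval_var G' K' j Z else 0
  | _, _ => 0
  end.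

Definition eval_mul G K P Q Z (f : mten G P (mten G Q Z) ~> A \ox mten G Q Z)
    (g : mten G Q Z ~> A \ox Z) : mten G K Z ~> A \ox Z :=
  mul_tail Z \o ((idm A \oxm g) \o (f \o shuf G K P Q Z)).

Local Notation msk G s := (mask_of (size G) s).

(** All orderings of the same variables share the source [mten G K Z], whose factors follow the
    order of [G]; the shuffles carry the permutation. Differently ordered words can therefore be
    added. *)
Fixpoint eval G K e Z : mten G K Z ~> A \ox Z :=
  match e with
  | Var i => eval_var G K i Z
  | Mul a b => eval_mul K (eval G (msk G (vars a)) a (mten G (msk G (vars b)) Z))
                        (eval G (msk G (vars b)) b Z)
  | Add a b => eval G K a Z + eval G K b Z
  | Opp a => - eval G K a Z
  end.

Fixpoint eval_word G K (w : seq nat) Z : mten G K Z ~> A \ox Z :=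
  match w with
  | [::] => 0
  | i :: w' =>
    if nilp w' then eval_var G K i Z
    else eval_mul K (eval_var G (msk G [:: i]) i (mten G (msk G w') Z))
                  (eval_word G (msk G w') w' Z)
  end.

Lemma empty_tail_nat G K Z W (f : Z ~> W) :
  empty_tail G K W \o mtenm G K f = f \o empty_tail G K Z.
Proof.
by elim: G K => [|x G IHG] [|[] K] //=; rewrite ?cmp1m ?cmpm1 ?cmp0m ?cmpm0.
Qed.

Lemma empty_tail_pass X G K Z :
  empty_tail G K (X \ox Z) \o pass X G K Z = idm X \oxm empty_tail G K Z.
Proof.
by elim: G K => [|x G IHG] [|[] K] //=; rewrite ?tenm1 ?cmp1m ?cmp0m ?tenm0.
Qed.

Lemma eval_var_nat G K i Z W (f : Z ~> W) :
  eval_var G K i W \o mtenm G K f = (idm A \oxm f) \o eval_var G K i Z.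
Proof.
elim: G K i => [|x G IHG] [|[] K] [|i] //=; rewrite ?cmpm0 ?cmp0m //.
by rewrite -!tenm_cmp empty_tail_nat cmp1m cmpm1.
Qed.

Lemma eval_var_pass X G K i Z :
  tswap X A Z \o (idm X \oxm eval_var G K i Z)
  = eval_var G K i (X \ox Z) \o pass X G K Z.
Proof.
elim: G K i => [|x G IHG] [|[] K] [|i] //=; rewrite ?cmp0m ?tenm0 ?cmpm0 //.
by rewrite tswap_nat cmpA -tenm_cmp empty_tail_pass cmpm1.
Qed.

Lemma eval_nat G K e Z W (f : Z ~> W) :
  multilinear e -> K = msk G (vars e) ->
  eval G K e W \o mtenm G K f = (idm A \oxm f) \o eval G K e Z.
Proof.
elim: e K Z W f => [i | a IHa b IHb | a IHa b IHb | a IHa] K Z W f /=.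
- by move=> _ _; exact: eval_var_nat.
- case/and3P=> la lb ab ->; rewrite /eval_mul -!cmpA.
  rewrite shuf_nat ?splits_mask // (cmp2 (IHa _ _ _ _ la erefl)) -!cmpA.
  rewrite (cmp2 (esym (ten1_cmp _ _ _))) IHb // ten1_cmp -!cmpA.
  by rewrite (cmp2 (mul_tail_nat _)) -cmpA.
- case/and3P=> la lb ab KE; rewrite cmpDm cmpmD IHa // IHb //.
  by rewrite KE; exact: eq_mask_of.
- by move=> la KE; rewrite cmpNm cmpmN IHa.
Qed.

Lemma eval_pass X G K e Z : multilinear e -> K = msk G (vars e) ->
  tswap X A Z \o (idm X \oxm eval G K e Z)
  = eval G K e (X \ox Z) \o pass X G K Z.
Proof.
elim: e K Z => [i | a IHa b IHb | a IHa b IHb | a IHa] K Z /=.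
- by move=> _ _; exact: eval_var_pass.
- case/and3P=> la lb ab ->; rewrite /eval_mul !ten1_cmp -!cmpA.
  rewrite (cmp2 (mul_tail_tswap _ _)) -!cmpA (cmp2 (tswap_nat _ _ _)) -!cmpA.
  rewrite (cmp2 (esym (ten1_cmp A _ _))) IHb // (cmp2 (IHa _ _ la erefl)).
  rewrite ten1_cmp -!cmpA pass_shuf ?splits_mask //.
  by rewrite (cmp2 (eval_nat _ la erefl)) -!cmpA.
- case/and3P=> la lb ab KE; rewrite cmpDm tenmD cmpmD IHa // IHb //.
  by rewrite KE; exact: eq_mask_of.
- by move=> la KE; rewrite cmpNm tenmN cmpmN IHa.
Qed.

(* [b] is moved past the objects of [a] one at a time, by [eval_pass]. *)
Lemma eval_mulC G a b Z (K := msk G (vars a ++ vars b)) (P := msk G (vars a))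
    (Q := msk G (vars b)) :
  multilinear a -> multilinear b -> uniq (vars a ++ vars b) ->
  eval_mul K (eval G Q b (mten G P Z)) (eval G P a Z) =
  mul_tail Z \o (tswap A A Z \o ((idm A \oxm eval G Q b Z)
     \o (eval G P a (mten G Q Z) \o shuf G K P Q Z))).
Proof.
move=> la lb ab; have KPQ : splits K P Q by exact: splits_mask.
rewrite /eval_mul; congr (_ \o _).
have slide G1 Q1 : exists2 u : mten G1 Q1 (A \ox Z) ~> A \ox mten G1 Q1 Z,
    pass A G1 Q1 Z \o u = idm _ &
    eval G P a (mten G1 Q1 Z) \o mswap (@projT1 _ _) G1 Q1 G P Z
    = u \o mtenm G1 Q1 (eval G P a Z).
  elim: G1 Q1 => [|y G1 IHG1] [|[] Q1] /=;
    try by exists (idm _); rewrite ?cmp1m ?cmpm1.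
    have [u uK uE] := IHG1 Q1.
    exists (tswap (projT1 y) A _ \o (idm _ \oxm u)).
      by rewrite -!cmpA (cmp2 (tswapK _ _ _)) cmp1m -ten1_cmp uK tenm1.
    by rewrite cmpA -eval_pass // -!cmpA -!ten1_cmp uE.
  exact: IHG1.
have [u uK uE] := slide G Q.
rewrite -(shufC _ _ _ KPQ) (cmp2 uE).
have -> : (idm A \oxm eval G Q b Z) =
    tswap A A Z \o (eval G Q b (A \ox Z) \o pass A G Q Z).
  by rewrite -eval_pass // (cmp2 (tswapK _ _ _)) cmp1m.
rewrite -!cmpA (cmp2 uK) cmp1m (cmp2 (tswapK _ _ _)) cmp1m.
by rewrite (cmp2 (eval_nat _ lb erefl)) -!cmpA.
Qed.

(** The factor [f] occurs with the two tails [mten G Q (mten G S Z)] and [mten G N Z], so it has to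
    be a family natural in the tail. *)
Lemma eval_mulA G K M N P Q S Z (f : forall W, mten G P W ~> A \ox W)
    (g : mten G Q (mten G S Z) ~> A \ox mten G S Z) (h : mten G S Z ~> A \ox Z) :
  (forall W V (u : W ~> V), f V \o mtenm G P u = (idm A \oxm u) \o f W) ->
  splits K M S -> splits M P Q -> splits K P N -> splits N Q S ->
  eval_mul K (eval_mul M (f _) g) h = eval_mul K (f _) (eval_mul N g h).
Proof.
move=> f_nat KMS MPQ KPN NQS; rewrite /eval_mul !ten1_cmp -!cmpA.
rewrite (cmp2 (esym (mul_tail_nat _))) -!cmpA (cmp2 (mul_tailA _)) -!cmpA.
by rewrite (shufA _ _ _ KMS MPQ KPN NQS) (cmp2 (f_nat _ _ _)) -!cmpA.
Qed.

Lemma eval_mulDl G K P Q Z (f1 f2 : mten G P (mten G Q Z) ~> A \ox mten G Q Z)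
    (g : mten G Q Z ~> A \ox Z) :
  eval_mul K (f1 + f2) g = eval_mul K f1 g + eval_mul K f2 g.
Proof. by rewrite /eval_mul cmpDm !cmpmD. Qed.

Lemma eval_mulDr G K P Q Z (f : mten G P (mten G Q Z) ~> A \ox mten G Q Z)
    (g1 g2 : mten G Q Z ~> A \ox Z) :
  eval_mul K f (g1 + g2) = eval_mul K f g1 + eval_mul K f g2.
Proof. by rewrite /eval_mul tenmD cmpDm !cmpmD. Qed.

Lemma eval_mulNl G K P Q Z (f : mten G P (mten G Q Z) ~> A \ox mten G Q Z)
    (g : mten G Q Z ~> A \ox Z) :
  eval_mul K (- f) g = - eval_mul K f g.
Proof. by rewrite /eval_mul cmpNm !cmpmN. Qed.

Lemma eval_mulNr G K P Q Z (f : mten G P (mten G Q Z) ~> A \ox mten G Q Z)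
    (g : mten G Q Z ~> A \ox Z) :
  eval_mul K f (- g) = - eval_mul K f g.
Proof. by rewrite /eval_mul tenmN cmpNm !cmpmN. Qed.

Lemma eval_mul_sum I J (r : seq I) (s : seq J) G K P Q Z
    (f : I -> (mten G P (mten G Q Z) ~> A \ox mten G Q Z))
    (g : J -> (mten G Q Z ~> A \ox Z)) :
  eval_mul K (\sum_(i <- r) f i) (\sum_(j <- s) g j)
  = \sum_(i <- r) \sum_(j <- s) eval_mul K (f i) (g j).
Proof.
rewrite /eval_mul cmp_summ !cmpm_sum; apply: eq_bigr => i _.
by rewrite tenm_sum cmp_summ cmpm_sum.
Qed.

Lemma eval_word_cat G K P Q (u v : seq nat) Z :
  K = msk G (u ++ v) -> P = msk G u -> Q = msk G v -> uniq (u ++ v) ->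
  (0 < size u)%N -> (0 < size v)%N ->
  eval_word G K (u ++ v) Z
  = eval_mul K (eval_word G P u (mten G Q Z)) (eval_word G Q v Z).
Proof.
move=> -> -> ->; elim: u => // i u IHu uniq_uv _ v_gt0 {K P Q}.
have u_v : uniq (u ++ v) by case/andP: uniq_uv.
have [/size0nil-> | w_gt0] := posnP (size u).
  by rewrite /= /nilp eqn0Ngt v_gt0.
rewrite /= /nilp size_cat addn_eq0 !eqn0Ngt w_gt0 /= IHu //.
rewrite (eval_mulA (f := fun W => eval_var G _ i W) (N := msk G (u ++ v))) //.
- by move=> W V f; exact: eval_var_nat.
- exact: (@splits_mask _ (i :: u)).
- by apply: (@splits_mask _ [:: i]); move: uniq_uv; rewrite cat_uniq => /andP[].
- exact: (@splits_mask _ [:: i]).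
- exact: splits_mask.
Qed.

Lemma eval_expand G K e Z : multilinear e -> K = msk G (vars e) ->
  eval G K e Z = \sum_(w <- (expand e).1) eval_word G K w Z
               - \sum_(w <- (expand e).2) eval_word G K w Z.
Proof.
elim: e K Z => [i | a IHa b IHb | a IHa b IHb | a IHa] K Z.
- by move=> _ _; rewrite /= big_seq1 big_nil subr0.
- move=> lab KE; have /= /and3P[la lb ab] := lab.
  have pa := expand_perm la; have pb := expand_perm lb.
  rewrite IHa // IHb //; move: pa pb.
  case: (expand a) (expand b) => [sa ta] [sb tb] /= pa pb.
  have E (s t : seq (seq nat)) : {subset s <= sa ++ ta} -> {subset t <= sb ++ tb} ->
    eval_mul K
      (\sum_(u <- s) eval_word G (msk G (vars a)) u (mten G (msk G (vars b)) Z))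
      (\sum_(v <- t) eval_word G (msk G (vars b)) v Z)
    = \sum_(w <- [seq u ++ v | u <- s, v <- t]) eval_word G K w Z.
    move=> /= ss st; rewrite eval_mul_sum big_allpairs_dep.
    apply: eq_big_seq => u /ss/pa up; apply: eq_big_seq => v /st/pb vp.
    have uv : perm_eq (u ++ v) (vars a ++ vars b) by exact: perm_cat.
    rewrite -(eval_word_cat (u := u)) ?(perm_uniq uv) //.
    + by rewrite KE; apply/esym; exact: eq_mask_of.
    + by apply/esym; exact: eq_mask_of.
    + by apply/esym; exact: eq_mask_of.
    + by rewrite (perm_size up) vars_gt0.
    + by rewrite (perm_size vp) vars_gt0.
  rewrite eval_mulDl !eval_mulDr !eval_mulNl !eval_mulNr !E;
    try by move=> w ws; rewrite mem_cat ws ?orbT.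
  rewrite !big_cat /= opprK opprD -!addrA; congr (_ + _).
  by rewrite addrA addrC.
- move=> /= /and3P[la lb ab] KE; rewrite IHa // IHb //; last first.
    by rewrite KE; exact: eq_mask_of.
  case: (expand a) (expand b) => [sa ta] [sb tb] /=.
  by rewrite !big_cat /= opprD addrACA.
- move=> /= la KE; rewrite IHa //; case: (expand a) => [sa ta] /=.
  by rewrite opprB.
Qed.

(** Through [eval_expand], a computation with lists of words proves an identity of morphisms. *)
Lemma eval_same G K a b Z : same_expansion a b -> K = msk G (vars b) ->
  eval G K a Z = eval G K b Z.
Proof.
case/and4P=> la lb ab E KE; rewrite !eval_expand //; last first.
  by rewrite KE; apply/esym; exact: eq_mask_of.
apply/eqP; rewrite subr_eq addrAC eq_sym subr_eq -!big_cat /=.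
by apply/eqP/esym/perm_big.
Qed.

End Evaluation.

(** * Factorization through subobjects *)

Section Factoring.
Variables (F : fieldType) (C : abCat F).
Implicit Types X Y Z : C.

(** A mono is the kernel of its cokernel. As a vanishing condition, factorization can be tested on
    epis and on the components of a coproduct. *)
Lemma factorsE X Y (f : X ~> Y) (S : subobj Y) :
  factors f S <-> cokm (sinc S) \o f = 0.
Proof.
have [cS SP] := mono_normal (@sinc_mono _ _ _ S).
split=> [[h <-] | cf]; first by rewrite cmpA cS cmp0m.
by have [h [hE _]] := SP _ _ cf; exists h.
Qed.

Lemma factors_epi W X Y (e : W ~> X) (f : X ~> Y) (S : subobj Y) :
  is_epi e -> factors (f \o e) S -> factors f S.
Proof.
by move=> eE /factorsE E; apply/factorsE/eE; rewrite cmp0m -cmpA.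
Qed.

Lemma factors_coproduct (B : nat -> C) X Y (i : forall n, B n ~> X) (f : X ~> Y)
    (S : subobj Y) :
  is_coproduct i -> (forall n, factors (f \o i n) S) -> factors f S.
Proof.
move=> iP fS; apply/factorsE/(coproduct_ext iP) => n.
by rewrite cmp0m -cmpA; apply/factorsE.
Qed.

Lemma factors_cmp W X Y (g : W ~> X) (f : X ~> Y) (S : subobj Y) :
  factors f S -> factors (f \o g) S.
Proof. by case=> h <-; exists (h \o g); rewrite cmpA. Qed.

Lemma factors_le X Y (f : X ~> Y) (S T : subobj Y) :
  factors f S -> sub_le S T -> factors f T.
Proof. by move=> [h <-] ST; rewrite -[h]cmp1m cmpA cmpm1; exact: factors_cmp. Qed.

Lemma factorsD X Y (f g : X ~> Y) (S : subobj Y) :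
  factors f S -> factors g S -> factors (f + g) S.
Proof. by move=> [h <-] [k <-]; exists (h + k); rewrite cmpmD. Qed.

(** If [g] and [h] agree after the corestriction, [f] factors through the kernel of [g - h], viewed
    as a subobject of [Y]; by minimality that kernel is the whole image. *)
Lemma image_epi X Y (f : X ~> Y) : is_epi (corestr (factors_image f)).
Proof.
set e := corestr _; have eE : sinc (image f) \o e = f by exact: corestrE.
move=> Z g h E; apply/eqP; rewrite -subr_eq0; apply/eqP.
have [k0 kP] := kerP (g - h).
have [|u [uE _]] := kP _ e; first by rewrite cmpBm E subrr.
have kM : is_mono (sinc (image f) \o kerm (g - h)).
  move=> W a b; rewrite -!cmpA => /(@sinc_mono _ _ _ (image f)).
  exact: (kernel_mono (kerP (g - h))).
have [|v vE] := @image_min _ _ _ _ f (Subobj kM).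
  by exists u; rewrite /= -cmpA uE.
have kv : kerm (g - h) \o v = idm _.
  by apply: (@sinc_mono _ _ _ (image f)); rewrite cmpA vE cmpm1.
by rewrite -(cmpm1 (g - h)) -kv cmpA k0 cmp0m.
Qed.

End Factoring.

Section TensorEpi.
Variables (F : fieldType) (C : symTensorCat F).
Implicit Types X Y Z : C.

Lemma ten_epil X Y Z (e : Y ~> Z) : is_epi e -> is_epi (idm X \oxm e).
Proof. by move=> /epi_conormal/(ten_cokl X); exact: cokernel_epi. Qed.

Lemma ten_epir X Y Z (e : Y ~> Z) : is_epi e -> is_epi (e \oxm idm X).
Proof. by move=> /epi_conormal/(ten_cokr X); exact: cokernel_epi. Qed.

Lemma factors_tone X Y (f : X ~> Y) (S : subobj Y) (h : X \ox tone ~> S \ox tone) :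
  f \oxm idm tone = (sinc S \oxm idm tone) \o h -> factors f S.
Proof.
move=> E; apply/factorsE/ten_tone_inj.
have [cS _] := mono_normal (@sinc_mono _ _ _ S).
by rewrite tencmp1 E cmpA -tencmp1 cS !ten0m cmp0m.
Qed.

End TensorEpi.

(** * Associativity of the tensor algebra *)

Section TensorAlgebra.
Variables (F : fieldType) (C : symTensorCat F) (V : C) (A : tensorAlg V).
Implicit Types X Y Z W : C.
Local Notation mu := (ta_mul A).

(** The two concatenations end in [tpow V (i + j + k)] and [tpow V (i + (j + k))], which are not
    convertible, so they are compared inside [A]. *)
Lemma tcatA i j k :
  ta_in A _ \o (tcat V (i + j) k \o (tcat V i j \oxm idm _)) =
  ta_in A _ \o (tcat V i (j + k) \o ((idm _ \oxm tcat V j k) \o tassoc _ _ _)).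
Proof.
(* Left multiplication by [V], raising the degree by one, carries the induction. *)
have [g [gE _]] := ta_suml A (X := V) (fun n => ta_in A n.+1).
elim: i => [|i IHi].
  by rewrite /= (cmp2 (tlunit_nat _)) -cmpA tlunit_tassoc.
rewrite [(i.+1 + j + k)%N]/= [(i.+1 + (j + k))%N]/= /= -!gE !tencmp1 -!cmpA.
rewrite (cmp2 (tassoc_nat _ _ _)) -!cmpA.
rewrite (cmp2 (esym (ten1_cmp _ (tcat _ _ _) _))).
rewrite (cmp2 (esym (ten1_cmp _ _ _))) IHi.
rewrite !ten1_cmp -!cmpA -pentagon -(tenm1 V (tpow V i)).
by rewrite (cmp2 (tassoc_nat _ _ _)) -!cmpA.
Qed.

(** Conjugating by [tsym] and [tassoc] moves [A] to the outside, where [ta_suml] applies. *)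
Lemma coproduct_mid X W Y (f g : (X \ox A) \ox W ~> Y) :
  (forall n, f \o ((idm X \oxm ta_in A n) \oxm idm W)
           = g \o ((idm X \oxm ta_in A n) \oxm idm W)) -> f = g.
Proof.
move=> E; apply: (iso_epi (f := tsym W (X \ox A))).
  by exists (tsym (X \ox A) W); rewrite !tsymK.
apply: (iso_epi (tassoc_iso W X A)).
apply: (coproduct_ext (ta_suml A (X := W \ox X))) => n.
rewrite -!cmpA -(tenm1 W X) tassoc_nat (cmp2 (tsym_nat _ _)) -!cmpA.
by rewrite (cmpA f) (cmpA g) E.
Qed.

Lemma ta_mulA : mu \o (mu \oxm idm A) = mu \o ((idm A \oxm mu) \o tassoc A A A).
Proof.
apply: (coproduct_ext (ta_suml A (X := A \ox A))) => k.
apply: coproduct_mid => j.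
apply: (iso_epi (inv_iso (tassoc_iso A (tpow V j) (tpow V k)))).
apply: (coproduct_ext (ta_sumr A (X := tpow V j \ox tpow V k))) => i.
have -> : ta_in A i \oxm idm (tpow V j \ox tpow V k)
        = ta_in A i \oxm (idm (tpow V j) \oxm idm (tpow V k)) by rewrite tenm1.
rewrite -!cmpA -/(tassoc' _ _ _) tassoc'_nat.
have E : (idm (A \ox A) \oxm ta_in A k)
    \o (((idm A \oxm ta_in A j) \oxm idm _) \o ((ta_in A i \oxm idm _) \oxm idm _))
    = (ta_in A i \oxm ta_in A j) \oxm ta_in A k.
  by rewrite -!tenm_cmp -tenm1 -tenm_cmp !cmp1m !cmpm1.
rewrite !(cmp3 E) (cmp2 (tassoc_nat _ _ _)) -!cmpA.
rewrite !(cmp2 (esym (tenm_cmp _ _ _ _))) !cmp1m !ta_mulE.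
have L := tcatA i j k.
rewrite -[ta_in A k in LHS]cmpm1 tenm_cmp -[ta_in A i in RHS]cmpm1 tenm_cmp.
rewrite -!cmpA (cmp2 (ta_mulE _ _ _)) (cmp2 (ta_mulE _ _ _)) -!cmpA.
by rewrite (cmp3 L) -!cmpA.
Qed.

End TensorAlgebra.

(** * Generalized elements and the subobjects that contain them *)

Section GeneralizedElements.
Variables (F : fieldType) (C : symTensorCat F) (V : C) (A : tensorAlg V).
Implicit Types X Y Z W : C.
Local Notation mu := (ta_mul A).
Local Notation gen := {X : C & X ~> A}.
Implicit Types G : seq gen.
Local Notation mten := (@mten F C gen (@projT1 _ _)).
Local Notation msk G e := (mask_of (size G) (vars e)).

(* The tail is carried along: up to [tassoc], a morphism [X ~> A] is the family
   [X \ox Z ~> A \ox Z]. *)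
Definition through G e Y (f : Y ~> A) : Prop := forall K Z, K = msk G e ->
  exists h, eval mu G K e Z = (f \oxm idm Z) \o h :> (mten G K Z ~> _).

Definition represents G e Y (f : Y ~> A) : Prop := forall K Z, K = msk G e ->
  exists2 h, is_iso h & eval mu G K e Z = (f \oxm idm Z) \o h :> (mten G K Z ~> _).

Definition lies_in G e (S : subobj A) : Prop := through G e (sinc S).

Lemma represents_through G e Y (f : Y ~> A) : represents G e f -> through G e f.
Proof. by move=> ef K Z KE; have [h _ hE] := ef K Z KE; exists h. Qed.

Lemma through_idm G e : through G e (idm A).
Proof. by move=> K Z _; exists (eval mu G K e Z); rewrite tenm1 cmp1m. Qed.

Lemma through_factors G e Y (f : Y ~> A) (S : subobj A) :
  through G e f -> factors f S -> lies_in G e S.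
Proof.
move=> ef [h hE] K Z KE; have [u uE] := ef K Z KE.
by exists ((h \oxm idm Z) \o u); rewrite uE cmpA -tencmp1 hE.
Qed.

(** The way back from expressions to morphisms: with tail [tone], the isomorphism in [represents] is
    inverted and the unit is cancelled. *)
Lemma represents_factors G e Y (f : Y ~> A) (S : subobj A) :
  represents G e f -> lies_in G e S -> factors f S.
Proof.
move=> ef eS; have [h hI hE] := ef _ tone erefl; have [u uE] := eS _ tone erefl.
apply: (@factors_tone _ _ _ _ _ _ (u \o inv hI)).
by rewrite cmpA -uE hE -cmpA Kinv cmpm1.
Qed.

Lemma empty_tail_iso G K Z : ~~ has id K -> is_iso (empty_tail G K Z).
Proof.
by elim: G K => [|x G IHG] [|[] K] //= KF; try exact: is_iso_idm; exact: IHG.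
Qed.

Lemma represents_var G i d : (i < size G)%N ->
  represents G (Var i) (projT2 (nth d G i)).
Proof.
move=> iG K Z ->; suff gen_mask j : exists2 h, is_iso h &
    eval_var G [seq k \in [:: (j + i)%N] | k <- iota j (size G)] i Z
    = (projT2 (nth d G i) \oxm idm Z) \o h by exact: (gen_mask 0%N).
elim: G j i iG => [|x G IHG] j [|i] //= iG.
  rewrite mem_seq1 addn0 eqxx; exists (idm _ \oxm empty_tail G _ Z).
    apply: ten_iso; first exact: is_iso_idm.
    apply: empty_tail_iso; rewrite has_map -all_predC; apply/allP=> k.
    by rewrite mem_iota /= => /andP[jk _]; rewrite mem_seq1 gtn_eqF.
  by rewrite -tenm_cmp cmpm1 cmp1m.
have -> : j \in [:: (j + i.+1)%N] = false.
  by rewrite mem_seq1 addnS ltn_eqF // ltnS leq_addr.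
by rewrite addnS -addSn; exact: IHG.
Qed.

Lemma eval_Mul G a b Z K :
  eval mu G K (Mul a b) Z =
  (mu \oxm idm Z) \o (tassoc' A A Z \o ((idm A \oxm eval mu G (msk G b) b Z)
    \o (eval mu G (msk G a) a _ \o shuf (@projT1 _ _) G K (msk G a) (msk G b) Z))).
Proof. by rewrite /= /eval_mul /mul_tail -lock -cmpA. Qed.

(** By [eval_mulC] both products start from the same shuffle, so their difference is [comm] applied
    to one morphism. *)
Lemma eval_Br G a b Z (K := mask_of (size G) (vars a ++ vars b)) :
  multilinear (Mul a b) ->
  eval mu G K (Br a b) Z =
  (comm A \oxm idm Z) \o (tassoc' A A Z \o ((idm A \oxm eval mu G (msk G b) b Z)
    \o (eval mu G (msk G a) a _ \o shuf (@projT1 _ _) G K (msk G a) (msk G b) Z))).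
Proof.
case/and3P=> la lb ab; rewrite [LHS]/= eval_mulC // /eval_mul -/K.
rewrite (cmpA _ (tswap _ _ _)) mul_tailC /mul_tail -lock.
rewrite -cmpBm -cmpBm -tenNm -tenDm.
by rewrite -cmpA /comm cmpmB cmpm1.
Qed.

Lemma pair_tail (c : A \ox A ~> A) X Y Z W T (f : X ~> A) (g : Y ~> A)
    (k : W ~> Y \ox Z) (h : T ~> X \ox W) :
  (c \oxm idm Z) \o (tassoc' A A Z
    \o ((idm A \oxm ((g \oxm idm Z) \o k)) \o ((f \oxm idm W) \o h)))
  = ((c \o (f \oxm g)) \oxm idm Z) \o (tassoc' X Y Z \o ((idm X \oxm k) \o h)).
Proof.
rewrite ten1_cmp -!cmpA (cmp2 (ten_swap f k)) -!cmpA tencmp1 -!cmpA.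
rewrite (cmp2 (esym (ten_split f (g \oxm idm Z)))) (cmp2 (tassoc'_nat _ _ _)).
by rewrite -!cmpA.
Qed.

Lemma represents_Mul G a b X Y (f : X ~> A) (g : Y ~> A) :
  multilinear (Mul a b) -> represents G a f -> represents G b g ->
  represents G (Mul a b) (mu \o (f \oxm g)) /\
  represents G (Br a b) (comm A \o (f \oxm g)).
Proof.
move=> lab af bg; have [la lb ab] := and3P lab.
split=> K Z ->; have [h hI hE] := af _ (mten G (msk G b) Z) erefl;
  have [k kI kE] := bg _ Z erefl;
  exists (tassoc' X Y Z \o ((idm X \oxm k) \o (h \o shuf (@projT1 _ _) G _ _ _ Z))).
1,3: apply: is_iso_cmp; first exact: inv_iso;
  apply: is_iso_cmp; first (by apply: ten_iso => //; exact: is_iso_idm);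
  by apply: is_iso_cmp => //; apply: shuf_iso; exact: splits_mask.
  by rewrite eval_Mul hE kE -(cmpA _ h) pair_tail.
by rewrite eval_Br // hE kE -(cmpA _ h) pair_tail.
Qed.

Lemma through_mul G a b X Y (f : X ~> A) (g : Y ~> A) :
  through G a f -> through G b g -> through G (Mul a b) (mu \o (f \oxm g)).
Proof.
move=> af bg K Z ->; have [h hE] := af _ (mten G (msk G b) Z) erefl.
have [k kE] := bg _ Z erefl.
exists (tassoc' X Y Z \o ((idm X \oxm k) \o (h \o shuf (@projT1 _ _) G _ _ _ Z))).
by rewrite eval_Mul hE kE -(cmpA _ h) pair_tail.
Qed.

Lemma through_br G a b X Y (f : X ~> A) (g : Y ~> A) :
  multilinear (Mul a b) ->
  through G a f -> through G b g -> through G (Br a b) (comm A \o (f \oxm g)).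
Proof.
move=> lab af bg K Z ->; have [h hE] := af _ (mten G (msk G b) Z) erefl.
have [k kE] := bg _ Z erefl.
exists (tassoc' X Y Z \o ((idm X \oxm k) \o (h \o shuf (@projT1 _ _) G _ _ _ Z))).
by rewrite eval_Br // hE kE -(cmpA _ h) pair_tail.
Qed.

Lemma lies_in_add G a b S : perm_eq (vars a) (vars b) ->
  lies_in G a S -> lies_in G b S -> lies_in G (Add a b) S.
Proof.
move=> ab aS bS K Z KE; have [h hE] := aS K Z KE.
have [|k kE] := bS K Z; first by rewrite KE; exact: eq_mask_of.
by exists (h + k); rewrite /= hE kE cmpmD.
Qed.

Lemma lies_in_opp G a S : lies_in G a S -> lies_in G (Opp a) S.
Proof.
by move=> aS K Z KE; have [h hE] := aS K Z KE; exists (- h); rewrite /= hE cmpmN.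
Qed.

Lemma lies_in_same G a b S :
  same_expansion a b -> lies_in G b S -> lies_in G a S.
Proof.
move=> ab bS K Z KE; have [_ _ pab _] := and4P ab.
have [|h hE] := bS K Z; first by rewrite KE; exact: eq_mask_of.
exists h; rewrite -hE; apply: (eval_same (ta_mulA A)) => //.
by rewrite KE; exact: eq_mask_of.
Qed.

Lemma lies_in_le G a S T : sub_le S T -> lies_in G a S -> lies_in G a T.
Proof. by move=> ST aS; exact: through_factors aS ST. Qed.

(** Expressions have no zero, so this is a sum of [n.+1] copies; the notation [a *+ n] undoes the
    shift. *)
Fixpoint Muln n a := if n is m.+1 then Add a (Muln m a) else a.

Lemma vars_Muln n a : vars (Muln n a) = vars a.
Proof. by case: n. Qed.

(** Every use of characteristic zero passes through this division; the identities call for 2, 3, 4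
    and 6. *)
Lemma lies_in_divn n G a S : [pchar F] =i pred0 ->
  lies_in G (Muln n a) S -> lies_in G a S.
Proof.
move=> charF naS K Z KE; have [|h hE] := naS K Z; first by rewrite vars_Muln.
have E : eval mu G K (Muln n a) Z = n.+1%:R *: eval mu G K a Z.
  elim: {naS h hE} n => [|n IHn]; first by rewrite scale1r.
  by rewrite [LHS]/= IHn -[X in X + _]scale1r -scalerDl nat1r.
have n0 : n.+1%:R != 0 :> F by rewrite (iffLR (pcharf0P F) charF).
exists (n.+1%:R^-1 *: h).
by rewrite cmpmZ -hE E scalerA mulVf // scale1r.
Qed.

End GeneralizedElements.

(** * The lower central series *)

Declare Scope expr_scope.
Delimit Scope expr_scope with E.
Bind Scope expr_scope with expr.
Notation "a + b" := (Add a b) : expr_scope.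
Notation "- a" := (Opp a) : expr_scope.
Notation "a - b" := (Add a (Opp b)) : expr_scope.
Notation "a * b" := (Mul a b) : expr_scope.
Notation "a *+ n" := (Muln n.-1 a) : expr_scope.
Notation "[ a , b ]" := (Br a b) (at level 0, a, b at level 99) : expr_scope.

Definition sym3 (f : expr -> expr -> expr -> expr) x y z : expr :=
  (f x y z + f y z x + f z x y + f x z y + f y x z + f z y x)%E.

Definition alt3 (f : expr -> expr -> expr -> expr) x y z : expr :=
  (f x y z + f y z x + f z x y - f x z y - f y x z - f z y x)%E.

(* The certificates below were found by linear algebra over Q in the space of
   multilinear words.  The identities in [alt3] were found with a single odd
   variable x in place of x, y, z: they are expansions of [[x^3,[v,b]]] in a free
   superalgebra. *)
Section Identities.
Local Notation x := (Var 0).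
Local Notation y := (Var 1).
Local Notation z := (Var 2).
Local Notation v := (Var 3).
Local Notation b := (Var 4).
Local Open Scope expr_scope.

(** The symmetric and the alternating sum add up to twice the cyclic sum xyz + yzx + zxy, and xyz
    exceeds yzx by [x, yz] and zxy by [xy, z]. *)
Lemma sym_alt_identity : same_expansion
  ([x * (y * z), [v, b]] *+ 6)
  (sym3 (fun x y z => [x * y * z, [v, b]]) x y z
   + alt3 (fun x y z => [x * y * z, [v, b]]) x y z
   + [[x, y * z], [v, b]] *+ 2 + [[x * y, z], [v, b]] *+ 2).
Proof. by vm_compute. Qed.

Lemma sym_identity : same_expansion
  (sym3 (fun x y z => [x * y * z, [v, b]]) x y z *+ 2)
  (sym3 (fun x y z => [x * y, [z * v + v * z, b]] *+ 3 - [x, [y * v * z, b]] *+ 6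
     + [x, [y, [v, [z, b]]]] *+ 3 - [x, [y, [z, [v, b]]]]) x y z).
Proof. by vm_compute. Qed.

Lemma alt_identity_ideal : same_expansion
  (alt3 (fun x y z => [x * y * z, [v, b]]) x y z)
  (alt3 (fun x y z => [v, [x, [y, z * b]]] - [v * x, [y, [z, b]]]
     + [x, [v, y * z * b]] - [x, [v * y, z * b]] + [x, [y, z * v * b]]
     - [x, [y * z, [v, b]]] + [x, [y * z * v, b]]) x y z).
Proof. by vm_compute. Qed.

Lemma alt_identity : same_expansion
  (alt3 (fun x y z => [x * y * z, [v, b]]) x y z *+ 4)
  (alt3 (fun x y z => [v, [x * y * z, b]] *+ 4
     + [x, [v, [y, z] * b]] *+ 2 - [x, [v, [[y, z], b]]]
     - [v, [x, [y, z] * b]] *+ 2 + [v, [x, [[y, z], b]]]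
     + [x, [y, [z, v] * b]] *+ 4 - [x, [y, [[z, v], b]]] *+ 2
     + [[x, [v, y * z]], b] *+ 2 + [b, x * [y, [v, z]]] *+ 4) x y z).
Proof. by vm_compute. Qed.

(* The case [[A, A L_3] <= L_4] of the theorem quoted above, with one variable kept
   innermost so that it can be taken in [L_j]. *)
Lemma ideal_identity (e := Var 0) (a := Var 1) (p := Var 2) (q := Var 3)
    (m := Var 4) : same_expansion
  ([e, a * [p, [q, m]]] *+ 3)
  ([a, [e, [q, p * m]]] - [a, [e * q, [p, m]]]
    + [a, [p, [e, q * m]]] - [a, [p * e, [q, m]]]
    + [a, [q, [p, e * m]]] - [a * q, [p, [e, m]]]
    + [e, [a, [p, q * m]]] + [e, [a * p, [q, m]]]
    + [e, [p, [q, a * m]]] - [e, [p * q, [a, m]]]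
    + [e, [q, [a, p * m]]] + [e * a, [p, [q, m]]]
    - [e * q, [a, [p, m]]] + [p, [a, [q, e * m]]]
    - [p, [a * q, [e, m]]] + [p, [e, [a, q * m]]]
    + [p, [q, [e, a * m]]] - [p * e, [a, [q, m]]]
    - [p * q, [e, [a, m]]] - [q, [a, [e, p * m]]] *+ 2
    + [q, [a * e, [p, m]]] - [q, [e, [p, a * m]]] *+ 2
    + [q, [e * p, [a, m]]] - [q, [p, [a, e * m]]] *+ 2
    + [q, [p * a, [e, m]]] + [q * a, [e, [p, m]]]
    + [q * e, [p, [a, m]]] + [q * p, [a, [e, m]]]
   ).
Proof. by vm_compute. Qed.

(** Put d = [t, m]. By the Leibniz rule the second and fourth terms give -[c, wd], and [w, cd] = [w,
    [c, d]] + [cw, d] - [c, wd] for every d. *)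
Lemma mul_comm_identity (w := Var 0) (c := Var 1) (t := Var 2) (m := Var 3) :
  same_expansion [w, c * [t, m]]
    ([w, [c, [t, m]]] + [c, [t, w] * m] + [c * w, [t, m]] - [c, [t, w * m]]).
Proof. by vm_compute. Qed.

End Identities.

(** * Inclusions between brackets, and the induction on degree *)

Section LowerCentralSeries.
Variables (F : fieldType) (C : symTensorCat F) (V : C) (A : tensorAlg V).
Hypothesis charF : [pchar F] =i pred0.
Implicit Types X Y Z : C.
Local Notation mu := (ta_mul A).
Local Notation gen := {X : C & X ~> A}.
Local Notation el f := (existT (fun X : C => X ~> A) _ f).
Local Notation el0 := (el (idm A)).
Implicit Types G : seq gen.
Local Notation L := (lcs A).

Lemma represents_el G i Y (f : Y ~> A) :
  (i < size G)%N -> nth el0 G i = el f -> represents G (Var i) f.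
Proof. by move=> iG E; have := @represents_var _ _ _ _ G i el0 iG; rewrite E. Qed.

Lemma through_el G i Y (f : Y ~> A) :
  (i < size G)%N -> nth el0 G i = el f -> through G (Var i) f.
Proof. by move=> iG E; apply: represents_through; exact: represents_el. Qed.

Lemma represents_Br G a b X Y (f : X ~> A) (g : Y ~> A) :
  multilinear (Mul a b) -> represents G a f -> represents G b g ->
  represents G (Br a b) (comm A \o (f \oxm g)).
Proof. by move=> lab af bg; case: (represents_Mul lab af bg). Qed.

Lemma represents_mul G a b X Y (f : X ~> A) (g : Y ~> A) :
  multilinear (Mul a b) -> represents G a f -> represents G b g ->
  represents G (Mul a b) (mu \o (f \oxm g)).
Proof. by move=> lab af bg; case: (represents_Mul lab af bg). Qed.

(** Together with [factors_epi], this allows a generic element of [L j.+2] to be written as a single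
    bracket. *)
Lemma lcs_epi j : exists2 e : A \ox L j.+1 ~> L j.+2, is_epi e &
  sinc (L j.+2) \o e = comm A \o (idm A \oxm sinc (L j.+1)).
Proof.
by exists (corestr (factors_image (comm A \o (idm A \oxm sinc (L j.+1)))));
  [exact: image_epi | exact: corestrE].
Qed.

Lemma ad_lcs j : factors (comm A \o (idm A \oxm sinc (L j.+1))) (L j.+2).
Proof. by have [e _ eE] := lcs_epi j; exists e. Qed.

Lemma lies_in_L1 G e : lies_in G e (L 1).
Proof. exact: through_idm. Qed.

Lemma lies_in_ad G a b j : multilinear (Mul a b) ->
  lies_in G b (L j.+1) -> lies_in G (Br a b) (L j.+2).
Proof.
move=> lab bj; apply: through_factors (ad_lcs j).
by apply: through_br => //; exact: through_idm.
Qed.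

Lemma lies_in_lcsS G a j : lies_in G a (L j.+1) -> lies_in G a (L j).
Proof. by apply: lies_in_le; exact: lcs_decr. Qed.

(* The Jacobi identity [[a, l], s] = [a, [l, s]] - [l, [a, s]]. *)
Lemma factors_br_lcs i j Y (s : Y ~> A) :
  factors (comm A \o (idm A \oxm s)) (L j.+2) ->
  factors (comm A \o (sinc (L i.+1) \oxm s)) (L (i + j).+2).
Proof.
elim: i j Y s => [|i IHi] j Y s sj; first exact: sj.
have [e eE Ee] := lcs_epi i.
apply: (factors_epi (ten_epir eE)); rewrite -cmpA -tenm_cmp Ee cmpm1.
pose G := [:: el (idm A); el (sinc (L i.+1)); el s].
apply: (@represents_factors _ _ _ _ G (Br (Br (Var 0) (Var 1)) (Var 2))).
  by do ?apply: represents_Br => //; exact: represents_el.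
apply: (@lies_in_same _ _ _ _ _ _ (Br (Var 0) (Br (Var 1) (Var 2))
  - Br (Var 1) (Br (Var 0) (Var 2)))%E) => //.
apply: lies_in_add => //; last apply: lies_in_opp.
  apply: lies_in_ad => //; apply: through_factors (IHi _ _ _ sj).
  by apply: through_br => //; exact: through_el.
rewrite addSnnS; apply: through_factors (IHi _ _ _ (ad_lcs j.+1)).
apply: through_br => //; first exact: through_el.
apply: through_factors sj.
by apply: through_br => //; [exact: through_idm | exact: through_el].
Qed.

Lemma lies_in_br G a b i j : multilinear (Mul a b) ->
  lies_in G a (L i.+1) -> lies_in G b (L j.+1) -> lies_in G (Br a b) (L (i + j).+2).
Proof.
move=> lab ai bj; apply: through_factors (factors_br_lcs _ (ad_lcs j)).
exact: through_br.
Qed.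

(* [[A, A L_(j+1)] \subset L_(j+2)]. *)
Definition ideal_lcs j : Prop :=
  factors (comm A \o (idm A \oxm (mu \o (idm A \oxm sinc (L j.+1))))) (L j.+2).

Lemma lies_in_br_mul G a u b i j : ideal_lcs j -> multilinear (Mul a (Mul u b)) ->
  lies_in G a (L i.+1) -> lies_in G b (L j.+1) ->
  lies_in G (Br a (Mul u b)) (L (i + j).+2).
Proof.
move=> jI laub ai bj; apply: through_factors (factors_br_lcs i jI).
by apply: through_br => //; apply: through_mul => //; exact: through_idm.
Qed.

Ltac lies_in_split :=
  repeat match goal with
  | |- lies_in _ (Add _ _) _ => apply: lies_in_add; [by [] | | ]
  | |- lies_in _ (Opp _) _ => apply: lies_in_opp
  end.

Ltac lies_in_series jI :=
  lies_in_split;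
  repeat match goal with
  | |- lies_in _ (Br _ (Mul _ (Var _))) _ =>
      apply: (lies_in_br_mul jI (i := 0)); 
        [by [] | exact: lies_in_L1 | exact: through_el]
  | |- lies_in _ (Br _ _) _ => apply: lies_in_ad; [by [] | ]
  | |- lies_in _ (Var _) _ => exact: through_el
  end.

(** Induction in steps of two, an element of L_(j+3) being written as [p, [q, m]] with m in L_(j+1).
    Each term of [ideal_identity] is a triple bracket ending in m or in a product um; in the latter
    case the induction hypothesis puts the innermost bracket in L_(j+2). *)
Lemma ideal_lcs_even j : ~~ odd j -> ideal_lcs j.
Proof.
move=> /even_halfK <-; elim: j./2 => [|n IHn] {j}.
  by apply: factors_cmp; rewrite -[comm A]cmpm1 -tenm1; exact: (ad_lcs 0).
rewrite doubleS; set j := n.*2 in IHn *.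
have [e1 e1E Ee1] := lcs_epi j; have [e2 e2E Ee2] := lcs_epi j.+1.
apply: (factors_epi (ten_epil (ten_epil e2E))).
rewrite -cmpA -ten1_cmp -(cmpA mu (idm A \oxm _)) -ten1_cmp Ee2.
apply: (factors_epi (ten_epil (ten_epil (ten_epil e1E)))).
rewrite -cmpA -ten1_cmp -(cmpA mu (idm A \oxm _)) -ten1_cmp.
rewrite -(cmpA (comm A) (idm A \oxm _)) -ten1_cmp Ee1.
pose G := [:: el0; el0; el0; el0; el (sinc (L j.+1))].
apply: (@represents_factors _ _ _ _ G
  (Br (Var 0) (Mul (Var 1) (Br (Var 2) (Br (Var 3) (Var 4)))))).
  do ?[apply: represents_Br => // | apply: represents_mul => //];
  exact: represents_el.
apply: (lies_in_divn (n := 2) charF); apply: (lies_in_same ideal_identity).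
rewrite /=; lies_in_series IHn.
Qed.


Lemma factors_br_mul j : ideal_lcs j ->
  factors (comm A \o (idm A \oxm (mu \o (sinc (L 2) \oxm sinc (L j.+2))))) (L j.+3).
Proof.
move=> jI; have [e eE Ee] := lcs_epi j.
apply: (factors_epi (ten_epil (ten_epil eE))).
rewrite -cmpA -ten1_cmp -(cmpA mu (sinc (L 2) \oxm _)) -tenm_cmp Ee cmpm1.
pose G := [:: el0; el (sinc (L 2)); el0; el (sinc (L j.+1))].
apply: (@represents_factors _ _ _ _ G
  (Br (Var 0) (Mul (Var 1) (Br (Var 2) (Var 3))))).
  do ?[apply: represents_Br => // | apply: represents_mul => //];
  exact: represents_el.
apply: (lies_in_same mul_comm_identity).
lies_in_split.
- by apply: lies_in_lcsS; lies_in_series jI.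
(* In [c, [t, w] m] the missing step comes from c in [L 2], whence [i := 1]. *)
- by apply: (lies_in_br_mul jI (i := 1)) => //; exact: through_el.
- by lies_in_series jI.
- by lies_in_series jI.
Qed.

Lemma lies_in_br_mul2 G a c b j : ideal_lcs j -> multilinear (Mul a (Mul c b)) ->
  lies_in G c (L 2) -> lies_in G b (L j.+2) -> lies_in G (Br a (Mul c b)) (L j.+3).
Proof.
move=> jI lab c2 bj; apply: through_factors (factors_br_mul jI).
by apply: through_br => //; [exact: through_idm | exact: through_mul].
Qed.

Definition deg2_part j : (tle V 2 \ox L j.+1) \bip L j.+3 ~> A :=
  ((comm A \o (tle_in A 2 \oxm sinc (L j.+1))) \o bpr1) + (sinc (L j.+3) \o bpr2).

(* [[A_(<= 2), L_(j+1)] + L_(j+3)]. *)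
Definition deg2_sub j : subobj A := image (deg2_part j).

Lemma deg2_tle j : factors (comm A \o (tle_in A 2 \oxm sinc (L j.+1))) (deg2_sub j).
Proof.
have := factors_cmp bin1 (factors_image (deg2_part j)).
by rewrite cmpDm -!cmpA bpr1_in1 bpr2_in1 cmpm0 addr0 cmpm1.
Qed.

Lemma deg2_lcs j : sub_le (L j.+3) (deg2_sub j).
Proof.
have := factors_cmp bin2 (factors_image (deg2_part j)).
by rewrite cmpDm -!cmpA bpr2_in2 bpr1_in2 !cmpm0 add0r cmpm1.
Qed.

Lemma deg2_epi j : exists2 e : (tle V 2 \ox L j.+1) \bip L j.+3 ~> deg2_sub j,
  is_epi e & sinc (deg2_sub j) \o e = deg2_part j.
Proof.
by exists (corestr (factors_image (deg2_part j)));
  [exact: image_epi | exact: corestrE].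
Qed.

Lemma tle_inS n : tle_in A n.+1 \o bin1 = tle_in A n.
Proof. by rewrite /= cmpDm -!cmpA bpr1_in1 bpr2_in1 cmpm0 addr0 cmpm1. Qed.

Lemma tle_in_top n : tle_in A n.+1 \o bin2 = ta_in A n.+1.
Proof. by rewrite /= cmpDm -!cmpA bpr2_in2 bpr1_in2 cmpm0 add0r cmpm1. Qed.

Lemma ta_in_tle n : (n <= 2)%N -> exists h, ta_in A n = tle_in A 2 \o h.
Proof.
case: n => [|[|[|]]] // _.
- by rewrite -[ta_in A 0]/(tle_in A 0) -(tle_inS 0) -(tle_inS 1) -cmpA; eexists.
- by rewrite -(tle_in_top 0) -(tle_inS 1) -cmpA; eexists.
- by rewrite -(tle_in_top 1); eexists.
Qed.

(** Since [tpow V 1] is [V \ox tone], a factor of degree one splits off only up to isomorphism. *)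
Lemma ta_in_split n : exists2 u, is_iso u &
  ta_in A n.+1 \o u = mu \o (ta_in A 1 \oxm ta_in A n).
Proof.
exists (tcat V 1 n); last by rewrite ta_mulE.
apply: is_iso_cmp (tassoc_iso _ _ _); apply: ten_iso (tlunit_iso _).
exact: is_iso_idm.
Qed.

Lemma through_ta_in_mul G a b i j : through G a (ta_in A i) ->
  through G b (ta_in A j) -> through G (Mul a b) (ta_in A (i + j)).
Proof.
move=> ai bj K Z KE; have [h hE] := through_mul ai bj Z KE.
by exists ((tcat V i j \oxm idm Z) \o h); rewrite hE ta_mulE tencmp1 -cmpA.
Qed.

(** * Lowering the degree of the first entry *)

Section DegreeReduction.
Variables (j n : nat).
Hypothesis smaller : forall d, (d < n)%N ->
  factors (comm A \o (ta_in A d \oxm sinc (L j.+1))) (deg2_sub j).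

Definition short G a : Prop := exists2 d, (d < n)%N & through G a (ta_in A d).

Lemma lies_in_short G a b : multilinear (Mul a b) -> short G a ->
  lies_in G b (L j.+1) -> lies_in G (Br a b) (deg2_sub j).
Proof.
move=> lab [d dn ad] bj; apply: through_factors (smaller dn).
exact: through_br.
Qed.

Lemma lies_in_tle G a b : multilinear (Mul a b) -> through G a (tle_in A 2) ->
  lies_in G b (L j.+1) -> lies_in G (Br a b) (deg2_sub j).
Proof.
move=> lab ad bj; apply: through_factors (deg2_tle j).
exact: through_br.
Qed.

Lemma lies_in_deg2 G a : lies_in G a (L j.+3) -> lies_in G a (deg2_sub j).
Proof. by apply: lies_in_le; exact: deg2_lcs. Qed.

End DegreeReduction.

Section CubicReduction.
Variables (j n : nat).
Hypothesis smaller : forall d, (d < n.+3)%N ->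
  factors (comm A \o (ta_in A d \oxm sinc (L j.+2))) (deg2_sub j.+1).

Variables (Y : C) (v : Y ~> A).
Let G : seq gen :=
  [:: el (ta_in A 1); el (ta_in A 1); el (ta_in A n.+1); el v; el (sinc (L j.+1))].

Local Notation x := (Var 0).
Local Notation y := (Var 1).
Local Notation z := (Var 2).
Local Notation b := (Var 4).
Local Notation U := (deg2_sub j.+1).

Let b_lcs : lies_in G b (L j.+1).
Proof. exact: through_el. Qed.

(** The degrees of x, y, z: their product has degree [n.+3], and one or two of them stay below
    it. *)
Let deg i := if i is 2 then n.+1 else 1.

Let var_deg i : (i < 3)%N -> through G (Var i) (ta_in A (deg i)).
Proof. by case: i => [|[|[|]]] // _; exact: through_el. Qed.

Let short_var i : (i < 3)%N -> short n.+3 G (Var i).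
Proof.
move=> i3; exists (deg i); last exact: var_deg.
by case: i i3 => [|[|[|]]].
Qed.

Let short_mul i k :
  [&& i < 3, k < 3 & i != k]%N -> short n.+3 G (Mul (Var i) (Var k)).
Proof.
case/and3P=> i3 k3 ik; exists (deg i + deg k)%N.
  2: by apply: through_ta_in_mul; exact: var_deg.
by case: i k i3 k3 ik => [|[|[|]]] [|[|[|]]] //= *; rewrite ?addn1 ?add1n.
Qed.

Ltac lies_in_lcs :=
  lies_in_split;
  repeat match goal with
  | |- lies_in _ (Br _ _) _ => apply: lies_in_ad; [by [] | lies_in_split]
  | |- lies_in _ (Var _) _ => exact: b_lcs
  end.

Ltac lies_in_short :=
  apply: (lies_in_short smaller);
    [by [] | first [exact: short_var | exact: short_mul] | ].

Lemma sym_part :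
  lies_in G (sym3 (fun x y z => [x * y * z, [Var 3, b]])%E x y z) U.
Proof.
apply: (lies_in_divn (n := 1) charF); apply: (lies_in_same sym_identity).
rewrite /sym3 /=; lies_in_split.
all: lies_in_short; try (by lies_in_lcs).
(* In the fourfold brackets the second entry lies in [L j.+4], two steps deeper than required. *)
all: by do 2!apply: lies_in_lcsS; lies_in_lcs.
Qed.

(** Here [v] is arbitrary: terms with first entry v or vx lie in L_(j+4). In all others the first
    entry is short, and [ideal_lcs j] keeps the second one in L_(j+2). *)
Lemma alt_part_ideal : ideal_lcs j ->
  lies_in G (alt3 (fun x y z => [x * y * z, [Var 3, b]])%E x y z) U.
Proof.
move=> jI; apply: (lies_in_same alt_identity_ideal).
rewrite /alt3; lies_in_split.
all: first [by apply: lies_in_deg2; lies_in_series jI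
  | lies_in_short; first [by lies_in_series jI
                         | by apply: lies_in_lcsS; lies_in_series jI]].
Qed.

(** Terms with first entry v are covered by its degree bound, and those with b in an outer bracket
    lie in L_(j+4), one of them by [A, A L_3] <= L_4. The rest have first entry x, y or z. *)
Lemma alt_part i : j = i.+1 -> ideal_lcs i -> through G (Var 3) (tle_in A 2) ->
  lies_in G (alt3 (fun x y z => [x * y * z, [Var 3, b]])%E x y z) U.
Proof.
move=> ji iI v2; have c_lcs c d : multilinear (Mul c d) -> lies_in G (Br c d) (L 2).
  by move=> cd; apply: lies_in_ad => //; exact: lies_in_L1.
have b_lcs2 : lies_in G b (L i.+2) by rewrite -ji.
have br_lcs a c : multilinear (Mul a (Mul c b)) -> lies_in G c (L 2) ->
    lies_in G (Br a (Mul c b)) (L j.+2).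
  by move=> acb c2; rewrite ji; apply: lies_in_br_mul2.
apply: (lies_in_divn (n := 3) charF); apply: (lies_in_same alt_identity).
rewrite /alt3 /=; lies_in_split.
all: match goal with
  | |- lies_in _ (Br (Br _ _) b) _ => apply: lies_in_deg2;
      apply: (lies_in_br (i := 2)); [by [] | | by []];
      apply: lies_in_ad; [by [] | exact: c_lcs]
  | |- lies_in _ (Br b _) _ => apply: lies_in_deg2; rewrite -(addn2 j.+2);
      apply: (lies_in_br_mul (j := 2)); [exact: ideal_lcs_even | by [] | by [] | ];
      apply: lies_in_ad; [by [] | exact: c_lcs]
  | |- lies_in _ (Br (Var 3) _) _ => apply: lies_in_tle; [by [] | by [] | ]
  | _ => lies_in_short
  end.
all: first [by apply: br_lcs; [ | exact: c_lcs] | by lies_in_lcs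
  | by apply: lies_in_lcsS; lies_in_lcs].
Qed.

Lemma cubic_reduction :
  lies_in G (alt3 (fun x y z => [x * y * z, [Var 3, b]])%E x y z) U ->
  factors (comm A \o (ta_in A n.+3 \oxm (comm A \o (v \oxm sinc (L j.+1))))) U.
Proof.
move=> altU.
have [u1 u1I u1E] := ta_in_split n.+2; have [u2 u2I u2E] := ta_in_split n.+1.
pose u := u1 \o (idm _ \oxm u2).
have uE : is_epi u.
  by apply: iso_epi; apply: is_iso_cmp => //; apply: ten_iso => //;
    exact: is_iso_idm.
apply: (factors_epi (ten_epir uE)).
rewrite -cmpA -tenm_cmp cmpm1 /u cmpA u1E -cmpA -tenm_cmp cmpm1 u2E.
apply: (@represents_factors _ _ _ _ G (Br (Mul x (Mul y z)) (Br (Var 3) b))).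
  do ?[apply: represents_Br => // | apply: represents_mul => //];
  exact: represents_el.
apply: (lies_in_divn (n := 5) charF); apply: (lies_in_same sym_alt_identity).
apply: lies_in_add => //.
  apply: lies_in_add => //; first by apply: lies_in_add => //; exact: sym_part.
  (* The commutator corrections lie in [L_2, L_(j+2)] <= L_(j+4). *)
  rewrite /=; lies_in_split; apply: lies_in_deg2;
  apply: (lies_in_br (i := 1) (j := j.+1)) => //;
  lies_in_lcs; exact: lies_in_L1.
rewrite /=; lies_in_split; apply: lies_in_deg2;
  apply: (lies_in_br (i := 1) (j := j.+1)) => //;
lies_in_lcs; exact: lies_in_L1.
Qed.

End CubicReduction.

Lemma factors_ta_in (S : subobj A) Y (s : Y ~> A) :
  (forall n, factors (comm A \o (ta_in A n \oxm s)) S) ->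
  factors (comm A \o (idm A \oxm s)) S.
Proof.
move=> nS; apply: (factors_coproduct (ta_sumr A (X := Y))) => n.
by rewrite -cmpA -tenm_cmp cmp1m cmpm1.
Qed.

(** Strong induction on the degree of the first entry; degrees at most two are in [deg2_sub] by
    construction. *)
Lemma degree_reduction j :
  (forall n, (forall d, (d < n.+3)%N ->
      factors (comm A \o (ta_in A d \oxm sinc (L j.+1))) (deg2_sub j)) ->
    factors (comm A \o (ta_in A n.+3 \oxm sinc (L j.+1))) (deg2_sub j)) ->
  sub_le (L j.+2) (deg2_sub j).
Proof.
move=> step; apply: image_min; apply: factors_ta_in => n.
elim/ltn_ind: n => n IHn; have [/ta_in_tle[h ->] | ] := leqP n 2; last first.
  by case: n IHn => [|[|[|n]]] // IHn _; exact: step.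
by rewrite -[sinc _]cmpm1 tenm_cmp cmpA; apply: factors_cmp; exact: deg2_tle.
Qed.

(** The second entry ranges over all of A, so [xy, z] = [x, yz] + [y, zx] lowers the degree. *)
Lemma lcs2_deg2 : sub_le (L 2) (deg2_sub 0).
Proof.
apply: degree_reduction => n smaller.
have [u uI uE] := ta_in_split n.+2.
apply: (factors_epi (ten_epir (iso_epi uI))).
rewrite -cmpA -tenm_cmp cmpm1 uE.
pose G := [:: el (ta_in A 1); el (ta_in A n.+2); el0].
apply: (@represents_factors _ _ _ _ G (Br (Mul (Var 0) (Var 1)) (Var 2))).
  do ?[apply: represents_Br => // | apply: represents_mul => //];
  exact: represents_el.
apply: (@lies_in_same _ _ _ _ _ _ (Br (Var 0) (Mul (Var 1) (Var 2))
  + Br (Var 1) (Mul (Var 2) (Var 0)))%E) => //.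
apply: lies_in_add => //.
  apply: (lies_in_short smaller) => //; last exact: lies_in_L1.
  by exists 1%N => //; exact: through_el.
apply: (lies_in_short smaller) => //; last exact: lies_in_L1.
by exists n.+2 => //; exact: through_el.
Qed.

Lemma lcs_deg2 j : sub_le (L j.+2) (deg2_sub j).
Proof.
elim: j => [|j IHj]; first exact: lcs2_deg2.
apply: degree_reduction => n smaller.
have [jI | ] := boolP (odd j); last first.
  (* For even [j], [L j.+2] is covered by brackets [v, b] with v arbitrary. *)
  move=> /ideal_lcs_even jI; have [e eE Ee] := lcs_epi j.
  apply: (factors_epi (ten_epil eE)); rewrite -cmpA -tenm_cmp Ee cmpm1.
  by apply: cubic_reduction => //; apply: alt_part_ideal.
case: j => // i in IHj smaller jI *.
have {}jI := ideal_lcs_even jI.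
(* For odd [j], now [i.+1], the induction hypothesis replaces L_(i+3) by [A_(<=2), L_(i+2)] +
   L_(i+4). On the first summand v has degree at most two; the second one brackets into L_(i+5). *)
have [h hE] := IHj; rewrite -hE -[ta_in A n.+3]cmpm1 tenm_cmp cmpA.
apply: factors_cmp; have [e eE Ee] := deg2_epi i.+1.
apply: (factors_epi (ten_epil eE)); rewrite -cmpA -tenm_cmp Ee cmpm1 tenmD cmpmD.
apply: factorsD.
  rewrite -[ta_in A n.+3]cmpm1 tenm_cmp cmpA; apply: factors_cmp.
  apply: cubic_reduction => //; apply: alt_part => //; exact: through_el.
rewrite -[ta_in A n.+3]cmpm1 tenm_cmp cmpA; apply: factors_cmp.
apply: factors_le (deg2_lcs _).
rewrite -[ta_in A n.+3]cmp1m -[sinc _]cmpm1 tenm_cmp cmpA.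
by apply: factors_cmp; exact: ad_lcs.
Qed.

End LowerCentralSeries.

(** * Passage to the quotients B_k *)

Section Quotient.
Variables (F : fieldType) (C : symTensorCat F) (V : C) (A : tensorAlg V).
Local Notation L := (lcs A).

(** The maps [t] and [h] identify L_(j+2) with [deg2_sub A j], so the projection to the quotient can
    be tested on the biproduct that covers it, where the summand L_(j+3) is killed. *)
Lemma lcq_ad_full j : sub_le (L j.+2) (deg2_sub A j) ->
  sub_le (sub_full (lcq A j.+2)) (lcq_ad_le A 2 j.+2).
Proof.
move=> [h hE]; set S := lcq_ad_le A 2 j.+2.
have piE : is_epi (lcq_pi A j.+2) by exact: cokernel_epi (cokP _).
apply: (factors_epi piE); rewrite cmp1m.
pose g := ((lcs_ad A j.+2 \o (tle_in A 2 \oxm idm (L j.+1))) \o bpr1)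
  + (lcs_inc A j.+2 \o bpr2).
have gE : sinc (L j.+2) \o g = deg2_part A j.
  rewrite cmpmD !cmpA !corestrE -(cmpA (comm A)) -tenm_cmp.
  by rewrite cmp1m cmpm1.
have [|t tE] := @image_min _ _ _ _ (deg2_part A j) (L j.+2); first by exists g.
have [e eE Ee] := deg2_epi A j.
have th : t \o h = idm _.
  by apply: (@sinc_mono _ _ _ (L j.+2)); rewrite cmpA tE hE cmpm1.
have te : t \o e = g.
  by apply: (@sinc_mono _ _ _ (L j.+2)); rewrite cmpA tE Ee gE.
rewrite -[lcq_pi _ _]cmpm1 -th cmpA; apply: factors_cmp.
apply: (factors_epi eE); rewrite -cmpA te cmpmD.
have [pi0 _] := cokP (lcs_inc A j.+2).
rewrite (cmpA _ (lcs_inc _ _)) [_ \o lcs_inc _ _]pi0 cmp0m addr0.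
rewrite !cmpA -lcq_adE -(cmpA (lcq_ad A j.+2)); apply: factors_cmp.
rewrite -tenm_cmp cmp1m cmpm1 -[tle_in A 2]cmpm1 -[lcq_pi _ _]cmp1m tenm_cmp cmpA.
by apply: factors_cmp; exact: factors_image.
Qed.

End Quotient.

Theorem corollary1p5 (K : fieldType) (charK : [pchar K]%R =i pred0)
    (C D : symTensorCat K) (E : tensEmb C D) (V : C) (A : tensorAlg (E V))
    (k : nat) (hk : (2 <= k)%N) :
  sub_eq (sub_full (lcq A k)) (lcq_ad_le A 2 k).
Proof.
split; last exact: factors_full.
case: k hk => [|[|j]] // _; apply: lcq_ad_full; exact: lcs_deg2.
Qed.
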